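(* Let $n,m,r\in\mathbb{N}$ with $r\ge 2$. Let $\mathcal{X}\subset\mathbb{R}^n$ be compact and let $\mu$ be a probability measure supported on $\mathcal{X}$ that is absolutely continuous with respect to Lebesgue measure. Let $\boldsymbol{y}_1,\dots,\boldsymbol{y}_r\in\mathbb{R}^n$ be pairwise distinct, let $\boldsymbol{\nu}=(\nu_1,\dots,\nu_r)\in\Delta^{r-1}$ (the standard simplex in $\mathbb{R}^r_{\ge 0}$), and let $\nu=\sum_{i=1}^r\nu_i\delta_{\boldsymbol{y}_i}$. Let $t\mapsto(\boldsymbol{A}_t,\boldsymbol{B}_t)\in\mathbb{R}^{n\times n}\times\mathbb{R}^{n\times m}$ be bounded and continuous on $[0,1]$, with state transition matrix $\boldsymbol{\Phi}_{ts}$, and suppose that it is uniformly controllable, i.e. $$\boldsymbol{M}_{ts}:=\int_s^t\boldsymbol{\Phi}_{t\tau}\boldsymbol{B}_\tau\boldsymbol{B}_\tau^\top\boldsymbol{\Phi}_{t\tau}^\top\,d\tau\succ \boldsymbol{0}\quad\text{for all } 0\le s<t\le 1.$$ Let the ground cost be $c=c_{\mathrm{MinEnergy}}$, where $$c_{\mathrm{MinEnergy}}(\boldsymbol{x},\boldsymbol{y}):=\min_{\boldsymbol{u}\in\mathcal{U}}\int_0^1\|\boldsymbol{u}_t\|_2^2\,dt\quad\text{subject to }\dot{\boldsymbol{x}}_t=\boldsymbol{A}_t\boldsymbol{x}_t+\boldsymbol{B}_t\boldsymbol{u}_t,\ \boldsymbol{x}_0=\boldsymbol{x},\ \boldsymbol{x}_1=\boldsymbol{y},$$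 and $\mathcal{U}=\{\boldsymbol{u}\in\mathcal{C}([0,1];\mathbb{R}^m):\int_0^1\|\boldsymbol{u}_t\|_2^2\,dt<\infty\}$. Consider the semi-discrete optimal transport problem of minimizing $\int_{\mathcal{X}}c(\boldsymbol{x},T(\boldsymbol{x}))\,d\mu(\boldsymbol{x})$ over maps $T:\mathcal{X}\to\{\boldsymbol{y}_1,\dots,\boldsymbol{y}_r\}$ with $T_\#\mu=\nu$. Then: (i) There exists a minimizer $T^{\mathrm{opt}}$ that is unique $\mu$-almost everywhere, and for some $\boldsymbol{\psi}\in\mathbb{R}^r$ solving $\boldsymbol{G}(\boldsymbol{\psi})=\boldsymbol{\nu}$ it is given $\mu$-almost everywhere by $T^{\mathrm{opt}}(\boldsymbol{x})=\boldsymbol{y}_i$ if $\boldsymbol{x}\in\mathrm{interior}(\mathrm{Lag}_i(\boldsymbol{\psi}))$, for all $i\in\{1,\dots,r\}$. (ii) $\mathcal{X}=\sqcup_{i=1}^r\mathrm{Lag}_i(\boldsymbol{\psi})$ is a convex polyhedral tessellation, i.e. the Laguerre cells $\mathrm{Lag}_1(\boldsymbol{\psi}),\dots,\mathrm{Lag}_r(\boldsymbol{\psi})$ form a tessellation of $\mathcal{X}$ and each cell $\mathrm{Lag}_i(\boldsymbol{\psi})$ is a convex polyhedron.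
   Context: For a ground cost $c:\mathcal{X}\times\{\boldsymbol{y}_i\}_{i=1}^r\to\mathbb{R}_{\ge0}$ and $\boldsymbol{\psi}=(\psi_1,\dots,\psi_r)\in\mathbb{R}^r$, the Laguerre cell associated to $\boldsymbol{y}_i$ is $$\mathrm{Lag}_i(\boldsymbol{\psi}):=\{\boldsymbol{x}\in\mathcal{X}: c(\boldsymbol{x},\boldsymbol{y}_i)+\psi_i\le c(\boldsymbol{x},\boldsymbol{y}_j)+\psi_j\ \text{for all } j\ne i\}.$$ By convention, $\boldsymbol{x}\in\mathrm{interior}(\mathrm{Lag}_i(\boldsymbol{\psi}))$ means that $\boldsymbol{x}\in\mathcal{X}$ satisfies these inequalities strictly for all $j\neq i$. The map $\boldsymbol{G}:\mathbb{R}^r\to\Delta^{r-1}$ has components $G_i(\boldsymbol{\psi}):=\int_{\mathrm{Lag}_i(\boldsymbol{\psi})}d\mu$. The cells form a tessellation of $\mathcal{X}$, written $\mathcal{X}=\sqcup_{i=1}^r\mathrm{Lag}_i(\boldsymbol{\psi})$, if their union is $\mathcal{X}$ and $\mathrm{vol}_n(\mathrm{Lag}_i(\boldsymbol{\psi})\cap\mathrm{Lag}_j(\boldsymbol{\psi}))=0$ for all $i\ne j$, where $\mathrm{vol}_n$ is $n$-dimensional Lebesgue measure. A convex polyhedron is a finite intersection of closed half-spaces of $\mathbb{R}^n$. The state transition matrix $\boldsymbol{\Phi}_{ts}$ is the solution of $\partial_t\boldsymbol{\Phi}_{ts}=\boldsymbol{A}_t\boldsymbol{\Phi}_{ts}$,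 $\boldsymbol{\Phi}_{ss}=\boldsymbol{I}$. $T_\#\mu$ denotes the pushforward of $\mu$ under $T$, and $\delta_{\boldsymbol{y}}$ the Dirac measure at $\boldsymbol{y}$.
   Formalization: For compact X that is not a convex polyhedron (e.g. a ball) cells need not be convex polyhedra; the formal theorem states that each Lag_i is X intersected with a convex polyhedron, and that Lag_i itself is a convex polyhedron whenever X is one. *)

(* Defs.v *)
(* Built on MathComp and MathComp-Analysis. *)
From HB Require Import structures.
From mathcomp Require Import all_boot all_order all_algebra.
From mathcomp Require Import all_classical all_reals all_analysis.

Set Implicit Arguments.
Unset Strict Implicit.
Unset Printing Implicit Defensive.

Import Order.TTheory GRing.Theory Num.Theory.
Import numFieldNormedType.Exports.

Local Open Scope classical_set_scope.
Local Open Scope ring_scope.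

(* Borel sigma-algebra on matrices, hence on R^n, taken as 'cV[R]_n. *)
Definition borel_mx_display : measure_display. Proof. exact: default_measure_display. Qed.

Section borel_mx.
Variables (R : realType) (p q : nat).

Definition borel_mx : set_system 'M[R]_(p, q) := <<s [set U | open U] >>.

Let borel_mx0 : borel_mx set0.
Proof. exact: sigma_algebra0. Qed.

Let borel_mxC U : borel_mx U -> borel_mx (~` U).
Proof. exact: sigma_algebraC. Qed.

Let borel_mx_bigcup (F : (set 'M[R]_(p, q))^nat) :
  (forall i, borel_mx (F i)) -> borel_mx (\bigcup_i F i).
Proof. exact: sigma_algebra_bigcup. Qed.

HB.instance Definition _ := @isMeasurable.Build borel_mx_display
  'M[R]_(p, q) borel_mx borel_mx0 borel_mxC borel_mx_bigcup.

End borel_mx.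

Lemma pushforward_product_sigma_finite d1 d2 d (T1 : measurableType d1)
    (T2 : measurableType d2) (T : measurableType d) (R : realType)
    (m1 : {sigma_finite_measure set T1 -> \bar R})
    (m2 : {sigma_finite_measure set T2 -> \bar R})
    (f : T1 * T2 -> T) (g : T -> T1 * T2) :
  measurable_fun setT g -> cancel f g ->
  sigma_finite setT (pushforward (m1 \x m2)%E f).
Proof.
move=> mg fK.
have /sigma_finiteP[F [TF ndF Foo]] := sigma_finiteT m1.
have /sigma_finiteP[G [TG ndG Goo]] := sigma_finiteT m2.
exists (fun k => g @^-1` (F k `*` G k)).
  rewrite -preimage_bigcup -[LHS](preimage_setT g); congr (_ @^-1` _).
  rewrite -setXTT TF TG predeqE => -[x y]; split.
    move=> [/= [i _ Fix] [j _ Gjy]]; exists (maxn i j) => //; split.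
    - by move: x Fix; exact/subsetPset/ndF/leq_maxl.
    - by move: y Gjy; exact/subsetPset/ndG/leq_maxr.
  by move=> [k _ []/= ? ?]; split; exists k.
move=> k; have [mF Fk] := Foo k; have [mG Gk] := Goo k.
have mFG : measurable (F k `*` G k) by exact: measurableX.
split; first by rewrite -[X in measurable X]setTI; exact: mg.
rewrite /pushforward (_ : f @^-1` _ = F k `*` G k).
  by rewrite product_measure1E// lte_mul_pinfty// ge0_fin_numE.
by apply/seteqP; split => x /=; rewrite fK.
Qed.

Section lebesgue_tuple.
Variable R : realType.
Local Notation mR := (measurableTypeR R).
Local Notation lebesgue := (@lebesgue_measure R).

Definition tuple_cons n (p : mR * n.-tuple mR) : n.+1.-tuple mR :=
  [the n.+1.-tuple mR of p.1 :: p.2].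

Lemma measurable_tuple_cons n : measurable_fun setT (@tuple_cons n).
Proof. by apply: measurable_cons; [exact: measurable_fst|exact: measurable_snd]. Qed.

Section step.
Variables (n : nat) (mu : {sigma_finite_measure set (n.-tuple mR) -> \bar R}).

Definition lebesgue_tuple_step : set (n.+1.-tuple mR) -> \bar R :=
  pushforward (lebesgue \x mu)%E (@tuple_cons n).

HB.instance Definition _ := Measure.copy lebesgue_tuple_step
  (measure_function_pushforward__canonical__measure_function_Measure
    (lebesgue \x mu)%E (@measurable_tuple_cons n)).

Let lebesgue_tuple_step_sigma_finite : sigma_finite setT lebesgue_tuple_step.
Proof.
apply: (@pushforward_product_sigma_finite _ _ _ mR (n.-tuple mR) _ R lebesgue mu _
    (fun t : n.+1.-tuple mR => (thead t, [tuple of behead t]))).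
- apply: measurable_fun_pair; last exact: measurable_behead.
  exact: (@measurable_tnth _ mR n.+1 ord0).
- by move=> [a t]; congr (_, _); exact/val_inj.
Qed.

HB.instance Definition _ := Measure_isSigmaFinite.Build _ _ _
  lebesgue_tuple_step lebesgue_tuple_step_sigma_finite.

End step.

Fixpoint lebesgue_tuple n : {sigma_finite_measure set (n.-tuple mR) -> \bar R} :=
  match n with
  | 0 => \d_([tuple] : 0.-tuple mR)
  | n'.+1 => lebesgue_tuple_step (lebesgue_tuple n')
  end.

Definition col_of_tuple n (t : n.-tuple mR) : 'cV[R]_n := \col_i tnth t i.

Lemma measurable_col_of_tuple n : measurable_fun setT (@col_of_tuple n).
Proof.
apply: (@measurability _ _ (n.-tuple mR) 'cV[R]_n setT (@col_of_tuple n)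
  [set U : set 'cV[R]_n | open U]) => // _ [U oU <-].
rewrite setTI.
pose box (qk : n.-tuple rat * nat) : set (n.-tuple mR) :=
  \bigcap_(i in [set: 'I_n])
    [set t | ball (ratr (tnth qk.1 i) : R) (qk.2.+1%:R^-1) (tnth t i)].
pose boxU (qk : n.-tuple rat * nat) : set (n.-tuple mR) :=
  if `[< box qk `<=` @col_of_tuple n @^-1` U >] then box qk else set0.
suff -> : @col_of_tuple n @^-1` U = \bigcup_qk boxU qk.
  apply: countable_bigcupT_measurable; first exact: countableP.
  move=> qk; rewrite /boxU.
  case: asboolP => // _.
  apply: fin_bigcap_measurable => // i _.
  rewrite -[X in measurable X]setTI.
  apply: (@measurable_tnth _ mR n i) => //.
  by rewrite ball_itv; exact: measurable_itv.
rewrite eqEsubset; split => [t Ut|t [qk _]]; last first.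
  by rewrite /boxU; case: asboolP => // + bt; exact.
have /nbhs_ballP[e /= e0 teU] : nbhs (col_of_tuple t) U by exact: open_nbhs_nbhs.
pose k := Num.truncn (e^-1 *+ 2).
have ke : (k.+1%:R^-1 : R) *+ 2 < e.
  rewrite -[_ *+ 2]mulr_natl ltr_pdivrMr// -ltr_pdivrMl// mulr_natr.
  exact: truncnS_gt.
have k0 : 0 < (k.+1%:R^-1 : R) by rewrite invr_gt0.
have [q qt] : exists q : n.-tuple rat,
    forall i, ball (ratr (tnth q i) : R) k.+1%:R^-1 (tnth t i).
  have /choice[q qP] (i : 'I_n) : exists a : rat,
      ball (ratr a : R) k.+1%:R^-1 (tnth t i).
    have [|a] := @rat_in_itvoo R (tnth t i - k.+1%:R^-1) (tnth t i + k.+1%:R^-1).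
      by rewrite ltrBlDr -addrA ltrDl addr_gt0.
    rewrite in_itv/= => /andP[a1 a2]; exists a.
    by rewrite /ball/= ltr_distl a1 a2.
  by exists (mktuple q) => i; rewrite tnth_mktuple.
exists (q, k) => //; rewrite /boxU asboolT; first by move=> i _ /=.
move=> s /= qs; apply: teU; split => // i j; rewrite !mxE.
apply: (@le_ball _ _ _ (k.+1%:R^-1 + k.+1%:R^-1)); first by rewrite -mulr2n ltW.
apply: (@ball_triangle _ _ (ratr (tnth q i : rat) : R)); first exact/ball_sym/qt.
exact: qs.
Qed.

(* n-dimensional Lebesgue measure, transported to columns from the iterated
   product measure on n-tuples. *)
Definition lebesgue_cV n : set 'cV[R]_n -> \bar R :=
  pushforward (lebesgue_tuple n) (@col_of_tuple n).

HB.instance Definition _ n := Measure.copy (@lebesgue_cV n)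
  (measure_function_pushforward__canonical__measure_function_Measure
    (lebesgue_tuple n) (@measurable_col_of_tuple n)).

End lebesgue_tuple.

Section control.
Variables (R : realType) (n m : nat).
Implicit Types (A : R -> 'M[R]_n) (B : R -> 'M[R]_(n, m)).
Implicit Types (u : R -> 'cV[R]_m) (z : R -> 'cV[R]_n).

(* Differential equations on [0,1] are read as: continuous on [0,1], with the
   equation on ]0,1[.  As the coefficients are continuous on [0,1], this is
   equivalent to requiring one-sided derivatives at the end points. *)
Definition is_state_transition A (Phi : R -> R -> 'M[R]_n) : Prop :=
  forall s : R, s \in `[0, 1] ->
    [/\ Phi s s = 1%:M,
        {within `[0, 1], continuous (Phi^~ s)} &
        forall t : R, t \in `]0, 1[ ->
          is_derive t (1 : R) (Phi^~ s) (A t *m Phi t s)].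

Definition gramian B (Phi : R -> R -> 'M[R]_n) (t s : R) : 'M[R]_n :=
  \matrix_(i, j) \int[lebesgue_measure]_(tau in `[s, t])
    (Phi t tau *m B tau *m (B tau)^T *m (Phi t tau)^T) i j.

Definition posdef (M : 'M[R]_n) : Prop :=
  M^T = M /\ forall v : 'cV[R]_n, v != 0 -> 0 < (v^T *m M *m v) ord0 ord0.

Definition uniformly_controllable B (Phi : R -> R -> 'M[R]_n) : Prop :=
  forall s t, 0 <= s -> s < t -> t <= 1 -> posdef (gramian B Phi t s).

Definition energy u : \bar R :=
  (\int[lebesgue_measure]_(t in `[0%R, 1%R]) (\sum_(i < m) u t i ord0 ^+ 2)%:E)%E.

Definition is_control u : Prop :=
  {within `[0, 1], continuous u} /\ (energy u < +oo)%E.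

Definition steers A B u (x y : 'cV[R]_n) : Prop :=
  exists z, [/\ {within `[0, 1], continuous z},
    forall t : R, t \in `]0, 1[ -> is_derive t (1 : R) z (A t *m z t + B t *m u t),
    z 0 = x & z 1 = y].

(* The minimum of S when it exists, and 0 otherwise. *)
Definition min_set (S : set R) : R := xget 0 [set e | S e /\ lbound S e].

Definition min_energy A B (x y : 'cV[R]_n) : R :=
  min_set [set fine (energy u) | u in [set u | is_control u /\ steers A B u x y]].

End control.

Section semidiscrete.
Variables (R : realType) (n r : nat).
Implicit Types (X : set 'cV[R]_n) (c : 'cV[R]_n -> 'cV[R]_n -> R).
Implicit Types (y : 'I_r -> 'cV[R]_n) (psi nu : 'I_r -> R).
Implicit Types (mu : {measure set 'cV[R]_n -> \bar R}) (T : 'cV[R]_n -> 'cV[R]_n).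

Definition laguerre X c y psi (i : 'I_r) : set 'cV[R]_n :=
  [set x | X x /\ forall j, j != i -> c x (y i) + psi i <= c x (y j) + psi j].

Definition laguerre_interior X c y psi (i : 'I_r) : set 'cV[R]_n :=
  [set x | X x /\ forall j, j != i -> c x (y i) + psi i < c x (y j) + psi j].

Definition laguerre_mass X mu c y psi : 'I_r -> R :=
  fun i => \int[mu]_(x in laguerre X c y psi i) 1.

Definition in_simplex nu : Prop := (forall i, 0 <= nu i) /\ \sum_i nu i = 1.

Definition discrete_measure y nu (S : set 'cV[R]_n) : \bar R :=
  (\sum_(i < r) (nu i)%:E * \d_(y i) S)%E.

(* Maps T : X -> {y_1, ..., y_r} are represented by total functions, of which
   only the restriction to X matters. *)
Definition transport_map X mu y nu T : Prop :=
  [/\ forall x, X x -> exists i, T x = y i,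
      measurable_fun X T &
      forall S, measurable S -> mu (X `&` T @^-1` S) = discrete_measure y nu S].

Definition transport_cost X mu c T : \bar R := (\int[mu]_(x in X) (c x (T x))%:E)%E.

Definition optimal_map X mu c y nu T : Prop :=
  transport_map X mu y nu T /\
  forall T', transport_map X mu y nu T' ->
    (transport_cost X mu c T <= transport_cost X mu c T')%E.

Definition tessellation X (L : 'I_r -> set 'cV[R]_n) : Prop :=
  \bigcup_i L i = X /\
  forall i j, i != j -> lebesgue_cV (L i `&` L j) = 0%E.

End semidiscrete.

Definition half_space (R : realType) n (a : 'cV[R]_n) (b : R) : set 'cV[R]_n :=
  [set x | (a^T *m x) ord0 ord0 <= b].

Definition convex_polyhedron (R : realType) n (C : set 'cV[R]_n) : Prop :=
  exists (k : nat) (a : 'I_k -> 'cV[R]_n) (b : 'I_k -> R),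
    (forall l, a l != 0) /\ C = \bigcap_l half_space (a l) (b l).

(* Main.v *)
Require Import Defs.
From mathcomp Require Import all_boot all_order all_algebra.
From mathcomp Require Import all_classical all_reals all_analysis.
From mathcomp Require Import measurable_realfun perm ring lra.
Set Implicit Arguments.
Unset Strict Implicit.
Unset Printing Implicit Defensive.
Import Order.TTheory GRing.Theory Num.Theory.
Import numFieldNormedType.Exports.
Local Open Scope classical_set_scope.
Local Open Scope ring_scope.

(** Two facts about the cost carry the theorem.

The first is a closed form: with M the Gramian, the minimal energy from x to y
is d^T M^-1 d at d = y - Phi 1 0 x (min_energyE).  Variation
of constants (steersP) says that u steers x to y exactly when the integral of
Phi 1 t B t u t is d.  The control u* t = (Phi 1 t B t)^T p with p = M^-1 d
does so with energy p^T d, and for every other admissible u the inequality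
|u|^2 >= 2 u* . u - |u*|^2 integrates to an energy at least p^T d.  Variation
of constants rests on uniqueness for linear equations, hence on Gronwall
(linear_ode_eq0): the explicit trajectory solves the equation, so it is the
only solution.  The same uniqueness gives the cocycle identity
Phi t s Phi s r = Phi t r, through which Phi t s is invertible and
continuous in s.

The second fact follows: x |-> c x (y i) - c x (y j) is affine, and its normal
is nonzero because Phi 1 0 and M are invertible and the y i are distinct
(quadratic_costB, cost_normal_neq0).  So every Laguerre cell is the trace on X
of a polyhedron, and two cells meet inside a hyperplane, which is Lebesgue-null
(lebesgue_hyperplane) and therefore mu-null.

What remains is semi-discrete transport for a bounded cost with null ties.  Let
envelope psi x be the minimum over i of c x (y i) + psi i, and consider the dual
function K psi, the integral of the envelope minus the pairing of nu and psi.
It is continuous, so it has a maximum on a box; K is invariant under adding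
constants, so a maximizer can be chosen with least coordinate 0.  Raising
psi i by e changes K by at least e times the mass of the new cell i minus
e nu i, so maximality bounds that mass by nu i, and letting e tend to 0 gives
mu (cell i) <= nu i (exists_dominated_potential).
When psi i is already at the top of the box, the cell is empty instead, as the
box is wider than the range of the cost.  The masses of the cells and the nu i
both sum to 1, so all these inequalities are equalities
(exists_laguerre_potential).

Finally, for a transport map T the excess of c x (T x) + psi (T x) over the
envelope is a nonnegative function, the gap, and the cost of T is K psi plus the
integral of the gap (transport_costE).  The Laguerre map has zero gap almost
everywhere, so it is optimal; another optimal map has zero gap almost
everywhere too, and inside a cell a zero gap determines the image. *)

(** * Continuity and derivatives of matrix-valued functions *)

Section matrix_continuity.
Variables (R : realType) (T : topologicalType).

Lemma continuous_mxP p q (F : T -> 'M[R]_(p, q)) :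
  continuous F <-> forall i j, continuous (fun x => F x i j).
Proof.
split=> [cF i j x|cF x].
  exact: (continuous_comp (cF x) (@coord_continuous _ _ _ i j _)).
apply/cvgrPdist_le => /= e e0; near=> z.
rewrite /Num.Def.normr/= mx_normrE (bigmax_le _ (ltW e0))//= => -[i j] _.
rewrite !mxE/=.
pose P (ij : 'I_p * 'I_q) z := `|F x ij.1 ij.2 - F z ij.1 ij.2| <= e.
rewrite -/(P (i, j) z).
move: (i, j); near: z; apply: filter_forall => /= ij.
exact: ((cvgrPdist_le _ _).1 (cF ij.1 ij.2 x)).
Unshelve. all: by end_near. Qed.

Lemma continuous_sumf (I : Type) (r : seq I) (P : pred I) (f : I -> T -> R) :
  (forall i, P i -> continuous (f i)) ->
  continuous (fun x => \sum_(i <- r | P i) f i x).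
Proof. by apply: continuous_big; exact: add_continuous. Qed.

Lemma continuous_prodf (I : Type) (r : seq I) (P : pred I) (f : I -> T -> R) :
  (forall i, P i -> continuous (f i)) ->
  continuous (fun x => \prod_(i <- r | P i) f i x).
Proof. by apply: continuous_big; exact: mul_continuous. Qed.

Lemma continuous_mulmx p q s (F : T -> 'M[R]_(p, q)) (G : T -> 'M[R]_(q, s)) :
  continuous F -> continuous G -> continuous (fun x => F x *m G x).
Proof.
move=> /continuous_mxP cF /continuous_mxP cG; apply/continuous_mxP => i j.
under eq_fun do rewrite mxE.
by apply: continuous_sumf => k _ x; apply: continuousM; [exact: cF|exact: cG].
Qed.

Lemma continuous_trmx p q (F : T -> 'M[R]_(p, q)) :
  continuous F -> continuous (fun x => (F x)^T).
Proof.
move=> /continuous_mxP cF; apply/continuous_mxP => i j.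
by under eq_fun do rewrite mxE; exact: cF.
Qed.

Lemma continuous_addmx p q (F G : T -> 'M[R]_(p, q)) :
  continuous F -> continuous G -> continuous (fun x => F x + G x).
Proof. by move=> cF cG x; apply: continuousD; [exact: cF|exact: cG]. Qed.

Lemma continuous_det p (F : T -> 'M[R]_p) :
  continuous F -> continuous (fun x => \det (F x)).
Proof.
move=> /continuous_mxP cF; apply: continuous_sumf => s _.
move=> x; apply: (@continuousM R T (fun=> (-1) ^+ s)
  (fun x => \prod_i F x i (s i))); first exact: cvg_cst.
by apply: continuous_prodf => i _; exact: cF.
Qed.

(** Cramer's formula: the entries of the inverse are cofactors over the
determinant, which are polynomials in the entries. *)
Lemma continuous_invmx p (F : T -> 'M[R]_p) :
  (forall x, F x \in unitmx) ->
  continuous F -> continuous (fun x => invmx (F x)).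
Proof.
move=> uF cF; apply/continuous_mxP => i j.
under eq_fun do rewrite /invmx uF !mxE.
move=> x; apply: (@continuousM R T (fun x => (\det (F x))^-1)
  (fun x => cofactor (F x) j i)).
  apply: continuousV; last exact: continuous_det.
  by have := uF x; rewrite unitmxE unitfE.
apply: (@continuousM R T (fun=> (-1) ^+ (j + i))
  (fun x => \det (row' j (col' i (F x))))); first exact: cvg_cst.
apply: continuous_det; apply/continuous_mxP => k l.
by under eq_fun do rewrite !mxE; move/continuous_mxP : cF; exact.
Qed.

End matrix_continuity.

Section matrix_derivative.
Variable R : realType.

Lemma is_derive_mxP p q (F : R -> 'M[R]_(p, q)) (t : R) (dF : 'M[R]_(p, q)) :
  is_derive t (1 : R) F dF <->
  forall i j, is_derive t (1 : R) (fun x => F x i j) (dF i j).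
Proof.
split=> [[Ft <-] i j|dFt].
  apply: DeriveDef; first by move/derivable_mxP : Ft; exact.
  by rewrite derive_mx// mxE.
have Ft : derivable F t 1 by apply/derivable_mxP => i j; case: (dFt i j).
apply: DeriveDef => //; rewrite derive_mx//; apply/matrixP => i j.
by rewrite mxE; case: (dFt i j).
Qed.

Lemma is_derive_sumf n (f : 'I_n -> R -> R) (t : R) (df : 'I_n -> R) :
  (forall i, is_derive t (1 : R) (f i) (df i)) ->
  is_derive t (1 : R) (fun x => \sum_i f i x) (\sum_i df i).
Proof.
move=> dfi; rewrite (_ : (fun x => _) = \sum_i f i).
  exact: is_derive_sum.
by apply/funext => x; rewrite fct_sumE.
Qed.

Lemma is_derive_mulf (f g : R -> R) (t df dg : R) :
  is_derive t (1 : R) f df -> is_derive t (1 : R) g dg ->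
  is_derive t (1 : R) (fun x => f x * g x) (df * g t + f t * dg).
Proof.
move=> dft dgt; rewrite (_ : _ + _ = f t *: dg + g t *: df); first exact: is_deriveM.
by rewrite addrC [df * _]mulrC.
Qed.

Lemma is_derive_mulmx p q s (F : R -> 'M[R]_(p, q)) (G : R -> 'M[R]_(q, s))
    (t : R) (dF : 'M[R]_(p, q)) (dG : 'M[R]_(q, s)) :
  is_derive t (1 : R) F dF -> is_derive t (1 : R) G dG ->
  is_derive t (1 : R) (fun x => F x *m G x) (dF *m G t + F t *m dG).
Proof.
move=> /is_derive_mxP dFt /is_derive_mxP dGt; apply/is_derive_mxP => i j.
rewrite (_ : (fun x => _) = fun x => \sum_k F x i k * G x k j); last first.
  by apply/funext => x; rewrite mxE.
rewrite !mxE -big_split/=; apply: is_derive_sumf => k.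
exact: is_derive_mulf.
Qed.

End matrix_derivative.

(** * Uniqueness for linear differential equations *)

Section gronwall.
Variable R : realType.

Lemma derivative_le_mul_nonincreasing (f df : R -> R) (C : R) :
  {within `[0, 1], continuous f} ->
  (forall t : R, t \in `]0, 1[ -> is_derive t (1 : R) f (df t)) ->
  (forall t : R, t \in `]0, 1[ -> df t <= C * f t) ->
  {in `[0, 1] &, {homo (fun t : R => f t * expR (- C * t)) : x y /~ x <= y}}.
Proof.
move=> cf dfP dfle.
have dg (t : R) : t \in `]0, 1[ -> is_derive t (1 : R) (fun t : R => f t * expR (- C * t))
    (df t * expR (- C * t) + f t * (expR (- C * t) * - C)).
  move=> t01; apply: is_derive_mulf; first exact: dfP.
  apply: is_derive1_comp; apply: is_derive_eq.
  by rewrite scaler1 ?mulr1 ?scaler0 ?addr0.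
apply: ler0_derive1_le_cc.
- by move=> t /dg[].
- move=> t t01; rewrite derive1E; have [_ ->] := dg t t01.
  have := dfle t t01; rewrite -(ler_pM2r (expR_gt0 (- C * t))) => h; nra.
- move=> x; apply: cvgM.
    exact: cf.
  apply: continuous_subspaceT => {}x.
  apply: continuous_comp; last exact: continuous_expR.
  by apply: continuousM; [exact: cvg_cst|exact: cvg_id].
Qed.

(** A solution of |f'| <= C f that vanishes at s vanishes on both sides of s:
f weighted by expR (- C t) decreases, which settles t >= s, and - f weighted by
expR (C t) decreases, which settles t <= s. *)
Lemma gronwall_eq0 (f df : R -> R) (C s : R) :
  {within `[0, 1], continuous f} ->
  (forall t : R, t \in `]0, 1[ -> is_derive t (1 : R) f (df t)) ->
  (forall t : R, t \in `]0, 1[ -> `|df t| <= C * f t) ->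
  (forall t, 0 <= f t) ->
  s \in `[0, 1] -> f s = 0 ->
  forall t, t \in `[0, 1] -> f t = 0.
Proof.
move=> cf dfP dfle f0 s01 fs0 t t01; apply/eqP; rewrite eq_le f0 andbT.
have [st|/ltW ts] := leP s t.
  have := @derivative_le_mul_nonincreasing f df C cf dfP _ t s t01 s01 st.
  rewrite fs0 mul0r pmulr_lle0 ?expR_gt0//; apply => x x01.
  by rewrite (le_trans (ler_norm _))// dfle.
have := @derivative_le_mul_nonincreasing (\- f) (\- df) (- C) _ _ _ s t s01 t01 ts.
rewrite /= fs0 oppr0 mul0r mulNr oppr_ge0 pmulr_lle0 ?expR_gt0//; apply.
- by move=> x; apply: continuousN; exact: cf.
- by move=> x /dfP dfx; exact: is_deriveN.
- move=> x x01; rewrite mulrN mulNr opprK.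
  by rewrite (le_trans (ler_norm _))// normrN dfle.
Qed.

End gronwall.

Section linear_ode.
Variables (R : realType) (n : nat) (A : R -> 'M[R]_n).
Hypothesis A_bounded : [bounded A t | t in `[0, 1]].

Lemma bounded_entries : exists2 K : R, 0 <= K &
  forall t, t \in `[0, 1] -> forall i j, `|A t i j| <= K.
Proof.
have [M [Mreal AM]] := A_bounded.
exists (`|M| + 1) => // t t01 i j.
have := AM (`|M| + 1); rewrite (le_lt_trans (ler_norm M)) ?ltrDl//.
move=> /(_ isT t t01)/=; apply: le_trans.
rewrite [leRHS]/Num.Def.normr/= mx_normrE.
exact: (le_bigmax _ (fun ij : 'I_n * 'I_n => `|A t ij.1 ij.2|) (i, j)).
Qed.

(** Gronwall applied to the sum of the squares of the entries of W, whose
derivative is bounded by 2 K n times itself when K bounds the entries of A. *)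
Lemma linear_ode_eq0 p (W : R -> 'M[R]_(n, p)) (s : R) :
  {within `[0, 1], continuous W} ->
  (forall t : R, t \in `]0, 1[ -> is_derive t (1 : R) W (A t *m W t)) ->
  s \in `[0, 1] -> W s = 0 ->
  forall t, t \in `[0, 1] -> W t = 0.
Proof.
move=> cW dW s01 Ws0.
have [K K0 AK] := bounded_entries.
pose f t := \sum_i \sum_j W t i j * W t i j.
pose df t := \sum_i \sum_j ((A t *m W t) i j * W t i j + W t i j * (A t *m W t) i j).
have W2_ge0 t i j : 0 <= W t i j * W t i j by rewrite -expr2 sqr_ge0.
have f_ge0 t : 0 <= f t by apply: sumr_ge0 => i _; exact: sumr_ge0.
have f_eq0 t : f t = 0 -> W t = 0.
  move=> ft0; apply/matrixP => i j; rewrite mxE.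
  have row_eq0 : \sum_j W t i j * W t i j = 0.
    by apply: (psumr_eq0P _ ft0) => // k _; exact: sumr_ge0.
  have : W t i j * W t i j = 0 by exact: (psumr_eq0P _ row_eq0).
  by move/eqP; rewrite mulf_eq0 orbb => /eqP.
have df_le t : t \in `]0, 1[ -> `|df t| <= (2 * K * n%:R) * f t.
  move=> t01; have t01' : t \in `[0, 1] by exact: subset_itv_oo_cc.
  have -> : 2 * K * n%:R * f t =
      \sum_i \sum_j \sum_(k < n) K * (W t i j * W t i j + W t k j * W t k j).
    have S1 : \sum_i \sum_j \sum_(k < n) W t i j * W t i j = n%:R * f t.
      rewrite mulr_sumr; apply: eq_bigr => i _; rewrite mulr_sumr; apply: eq_bigr => j _.
      by rewrite sumr_const card_ord mulr_natl.
    have S2 : \sum_(i < n) \sum_j \sum_(k < n) W t k j * W t k j = n%:R * f t.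
      by rewrite exchange_big/= exchange_big/= sumr_const card_ord mulr_natl exchange_big.
    under eq_bigr do under eq_bigr do rewrite -mulr_sumr big_split.
    under eq_bigr do rewrite -mulr_sumr big_split.
    by rewrite -mulr_sumr big_split/= S1 S2; ring.
  apply: le_trans (ler_norm_sum _ _ _) _; apply: ler_sum => i _.
  apply: le_trans (ler_norm_sum _ _ _) _; apply: ler_sum => j _.
  rewrite [W t i j * _]mulrC -mulrDl mxE -mulr2n mulrnAl mulr_suml -sumrMnl.
  apply: le_trans (ler_norm_sum _ _ _) _; apply: ler_sum => k _.
  have := AK t t01' i k; rewrite ler_norml => /andP[A1 A2].
  (* Young's inequality for the product of the entries (i, j) and (k, j). *)
  have W1 := sqr_ge0 (W t i j - W t k j); have W2 := sqr_ge0 (W t i j + W t k j).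
  rewrite -mulrA normrMn normrM -mulrnAr -normrMn ler_pM//=; first exact: AK.
  rewrite ler_norml mulr2n; apply/andP; split; nra.
move=> t t01; apply/f_eq0; apply: (@gronwall_eq0 R f df (2 * K * n%:R) s) => //.
- have cWij i j := (continuous_mxP (from_subspace _ W)).1 cW i j.
  apply: continuous_sumf => i _; apply: continuous_sumf => j _ x.
  by apply: cvgM; exact: cWij.
- move=> x /dW/is_derive_mxP dWx; apply: is_derive_sumf => i; apply: is_derive_sumf => j.
  exact: is_derive_mulf.
- rewrite /f Ws0; apply: big1 => i _; apply: big1 => j _; by rewrite mxE mul0r.
Qed.

End linear_ode.

(** * State transition matrices *)

Section state_transition.
Variables (R : realType) (n : nat) (A : R -> 'M[R]_n) (Phi : R -> R -> 'M[R]_n).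
Hypothesis A_bounded : [bounded A t | t in `[0, 1]].
Hypothesis Phi_transition : is_state_transition A Phi.

Lemma linear_ode_uniq p (V W : R -> 'M[R]_(n, p)) (f : R -> 'M[R]_(n, p)) (s : R) :
  {within `[0, 1], continuous V} -> {within `[0, 1], continuous W} ->
  (forall t : R, t \in `]0, 1[ -> is_derive t (1 : R) V (A t *m V t + f t)) ->
  (forall t : R, t \in `]0, 1[ -> is_derive t (1 : R) W (A t *m W t + f t)) ->
  s \in `[0, 1] -> V s = W s ->
  forall t, t \in `[0, 1] -> V t = W t.
Proof.
move=> cV cW dV dW s01 VWs t t01; apply/eqP; rewrite -subr_eq0; apply/eqP.
apply: (@linear_ode_eq0 R n A A_bounded p (V - W) s) => //.
- exact: within_continuousB.
- move=> x x01; apply: (is_derive_eq (is_deriveB (dV x x01) (dW x x01))).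
  by rewrite mulmxBr opprD addrACA subrr addr0.
- by rewrite -[LHS]/(V s - W s) VWs subrr.
Qed.

(** As functions of t, both sides solve the equation of A and agree at t = s. *)
Lemma transition_mul t s r : t \in `[0, 1] -> s \in `[0, 1] -> r \in `[0, 1] ->
  Phi t s *m Phi s r = Phi t r.
Proof.
move=> t01 s01 r01.
have [Phiss cs ds] := Phi_transition s01.
have [Phirr cr dr] := Phi_transition r01.
apply: (@linear_ode_uniq n (fun t => Phi t s *m Phi s r) (Phi^~ r) (fun=> 0) s) => //.
- apply: (@continuous_mulmx R (subspace `[(0 : R), 1]) n n n (Phi^~ s) (fun=> Phi s r)) => //.
  by move=> x; exact: cvg_cst.
- move=> x x01.
  apply: (is_derive_eq (is_derive_mulmx (ds x x01) (is_derive_cst (Phi s r) x 1))).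
  by rewrite mulmx0 !addr0 mulmxA.
- by move=> x x01; rewrite addr0; exact: dr.
- by rewrite /= Phiss mul1mx.
Qed.

Lemma transition_inv t s : t \in `[0, 1] -> s \in `[0, 1] ->
  Phi t s *m Phi s t = 1%:M.
Proof. by move=> t01 s01; rewrite transition_mul//; case: (Phi_transition t01). Qed.

Lemma transition_unit t s : t \in `[0, 1] -> s \in `[0, 1] -> Phi t s \in unitmx.
Proof. by move=> t01 s01; have [] := mulmx1_unit (transition_inv t01 s01). Qed.

(** The differential equation only controls the first argument; continuity in
the second one comes from Phi t s = Phi t 0 (Phi s 0)^-1. *)
Lemma transition_continuous_snd t : t \in `[0, 1] ->
  {within `[0, 1], continuous (Phi t)}.
Proof.
move=> t01; have m0 : (0 : R) \in `[0, 1] by rewrite in_itv/= lexx ler01.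
have [_ c0 _] := Phi_transition m0.
(* Outside the unit interval the transition matrix need not be invertible, so it
   is replaced there by the identity, which within the interval changes nothing. *)
pose P (s : R) : 'M[R]_n := if s \in `[0, 1] then Phi s 0 else 1%:M.
apply: (@subspace_eq_continuous _ _ _ (fun s => Phi t 0 *m invmx (P s))).
  move=> s /[!inE]/= s01; rewrite /P s01.
  by rewrite -(transition_mul t01 s01 m0) mulmxK// transition_unit.
apply: (@continuous_mulmx R (subspace `[(0 : R), 1]) n n n (fun=> Phi t 0)).
  by move=> x; exact: cvg_cst.
apply: (@continuous_invmx R (subspace `[(0 : R), 1])).
  by move=> s; rewrite /P; case: ifPn => [s01|_]; [exact: transition_unit|exact: unitmx1].
apply: (@subspace_eq_continuous _ _ _ (Phi^~ 0)) => //.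
by move=> s /[!inE]/= s01; rewrite /P s01.
Qed.

End state_transition.

(** * Integrals of matrix-valued functions *)

Lemma Rintegral_sum d (T : measurableType d) (R : realType)
    (mu : {measure set T -> \bar R}) (D : set T) n (f : 'I_n -> T -> R) :
  measurable D -> (forall i, mu.-integrable D (EFin \o f i)) ->
  \int[mu]_(x in D) (\sum_i f i x) = \sum_i \int[mu]_(x in D) f i x.
Proof.
move=> mD fi; rewrite /Rintegral; under eq_integral do rewrite -sumEFin.
rewrite integral_sum// sum_fine// => i _; apply: integrable_fin_num => //; exact: fi.
Qed.

Section mx_integral.
Variable R : realType.
Local Notation mu := (@lebesgue_measure R).

Definition mx_integral p q (a b : R) (F : R -> 'M[R]_(p, q)) : 'M[R]_(p, q) :=
  \matrix_(i, j) \int[mu]_(t in `[a, b]) F t i j.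

Lemma continuous_itv_integrable (a b : R) (f : R -> R) :
  {within `[a, b], continuous f} -> mu.-integrable `[a, b] (EFin \o f).
Proof. by move=> cf; apply: continuous_compact_integrable => //; exact: segment_compact. Qed.

Lemma mx_integral_mull p q s (a b : R) (C : 'M[R]_(p, q)) (F : R -> 'M[R]_(q, s)) :
  {within `[a, b], continuous F} ->
  mx_integral a b (fun t => C *m F t) = C *m mx_integral a b F.
Proof.
move=> cF; apply/matrixP => i j; rewrite !mxE.
have cFij k l := (continuous_mxP (from_subspace _ F)).1 cF k l.
under eq_Rintegral do rewrite mxE.
rewrite Rintegral_sum//; last first.
  move=> k; apply: continuous_itv_integrable => x.
  by apply: cvgM; [exact: cvg_cst|exact: cFij].
apply: eq_bigr => k _; rewrite mxE RintegralZl//.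
exact/continuous_itv_integrable/cFij.
Qed.

Lemma mx_integral_tr p q (a b : R) (F : R -> 'M[R]_(p, q)) :
  mx_integral a b (fun t => (F t)^T) = (mx_integral a b F)^T.
Proof.
by apply/matrixP => i j; rewrite !mxE; apply: eq_Rintegral => t _; rewrite mxE.
Qed.

Lemma mx_integral_mulr p q s (a b : R) (C : 'M[R]_(q, s)) (F : R -> 'M[R]_(p, q)) :
  {within `[a, b], continuous F} ->
  mx_integral a b (fun t => F t *m C) = mx_integral a b F *m C.
Proof.
move=> cF; apply: trmx_inj; rewrite -mx_integral_tr trmx_mul -mx_integral_tr.
rewrite -mx_integral_mull; last exact: (@continuous_trmx R (subspace _)).
by congr mx_integral; apply/funext => t; rewrite trmx_mul.
Qed.

Lemma mx_integral0 p q (F : R -> 'M[R]_(p, q)) : mx_integral 0 0 F = 0.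
Proof. by apply/matrixP => i j; rewrite !mxE set_itv1 Rintegral_set1. Qed.

Lemma is_derive_mx_integral p q (F : R -> 'M[R]_(p, q)) (t : R) :
  {within `[0, 1], continuous F} -> t \in `]0, 1[ ->
  is_derive t (1 : R) (fun x => mx_integral 0 x F) (F t).
Proof.
move=> cF t01; apply/is_derive_mxP => i j.
have cFij := (continuous_mxP (from_subspace _ F)).1 cF i j.
have /andP[t0 t1] : 0 < t < 1 by move: t01; rewrite in_itv.
have [] := @continuous_FTC1_closed R (fun x => F x i j) 0 t 1 t1 _ t0 _.
- exact: continuous_itv_integrable.
- exact: (within_continuous_continuous ltr01 cFij).
rewrite derive1E => dF F't; rewrite (_ : (fun x => _) =
  (fun x => \int[mu]_(t in `[0, x]) F t i j)); first exact: DeriveDef.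
by apply/funext => x; rewrite mxE.
Qed.

Lemma continuous_mx_integral p q (F : R -> 'M[R]_(p, q)) :
  {within `[0, 1], continuous F} ->
  {within `[0, 1], continuous (fun x => mx_integral 0 x F)}.
Proof.
move=> cF; apply/(continuous_mxP (from_subspace _ _)) => i j.
have cFij := (continuous_mxP (from_subspace _ F)).1 cF i j.
apply: subspace_eq_continuous (parameterized_integral_continuous ler01
  (continuous_itv_integrable cFij)) => x _.
by rewrite /from_subspace /parameterized_integral mxE.
Qed.

End mx_integral.

(** * The minimal energy *)

Section min_energy_quadratic.
Variables (R : realType) (n m : nat) (A : R -> 'M[R]_n) (B : R -> 'M[R]_(n, m)).
Variable (Phi : R -> R -> 'M[R]_n).
Hypothesis A_bounded : [bounded A t | t in `[0, 1]].
Hypothesis B_cont : {within `[0, 1], continuous B}.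
Hypothesis Phi_transition : is_state_transition A Phi.
Implicit Types (u : R -> 'cV[R]_m) (x y p : 'cV[R]_n) (t : R).
Local Notation mu := (@lebesgue_measure R).

Let m0 : (0 : R) \in `[0, 1]. Proof. by rewrite in_itv/= lexx ler01. Qed.
Let m1 : (1 : R) \in `[0, 1]. Proof. by rewrite in_itv/= ler01 lexx. Qed.

(** The integrand of the variation of constants formula at time t. *)
Definition forced (t : R) (u : R -> 'cV[R]_m) (tau : R) : 'cV[R]_n :=
  Phi t tau *m B tau *m u tau.

Lemma forced_continuous t u : t \in `[0, 1] -> {within `[0, 1], continuous u} ->
  {within `[0, 1], continuous (forced t u)}.
Proof.
move=> t01 cu; apply: (@continuous_mulmx R (subspace `[(0 : R), 1])) => //.
apply: (@continuous_mulmx R (subspace `[(0 : R), 1])) => //.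
exact: (transition_continuous_snd A_bounded Phi_transition).
Qed.

Definition trajectory x u (t : R) : 'cV[R]_n :=
  Phi t 0 *m (x + mx_integral 0 t (forced 0 u)).

Lemma trajectory_continuous x u : {within `[0, 1], continuous u} ->
  {within `[0, 1], continuous (trajectory x u)}.
Proof.
move=> cu; have [_ c0 _] := Phi_transition m0.
apply: (@continuous_mulmx R (subspace `[(0 : R), 1]) _ _ _ (Phi^~ 0)) => //.
apply: (@continuous_addmx R (subspace `[(0 : R), 1]) _ _ (fun=> x)).
  by move=> z; exact: cvg_cst.
exact/continuous_mx_integral/forced_continuous.
Qed.

Lemma trajectory_is_derive x u t : {within `[0, 1], continuous u} ->
  t \in `]0, 1[ ->
  is_derive t (1 : R) (trajectory x u) (A t *m trajectory x u t + B t *m u t).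
Proof.
move=> cu t01; have t01' : t \in `[0, 1] by exact: subset_itv_oo_cc.
have [_ _ d0] := Phi_transition m0.
have dI := is_derive_mx_integral (forced_continuous m0 cu) t01.
apply: (is_derive_eq (is_derive_mulmx (d0 t t01)
  (is_deriveD (is_derive_cst x t 1) dI))).
rewrite add0r /trajectory mulmxA; congr (_ + _).
by rewrite /forced !mulmxA (transition_inv A_bounded Phi_transition)// mul1mx.
Qed.

Lemma trajectory1 x u : {within `[0, 1], continuous u} ->
  trajectory x u 1 = Phi 1 0 *m x + mx_integral 0 1 (forced 1 u).
Proof.
move=> cu; rewrite /trajectory mulmxDr -mx_integral_mull; last exact: forced_continuous.
congr (_ + _); apply/matrixP => i j; rewrite !mxE; apply: eq_Rintegral => t.
rewrite inE => t01.
by rewrite /forced !mulmxA (transition_mul A_bounded Phi_transition).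
Qed.

(** The equation has the explicit solution trajectory x u, and it has no other
one starting at x, so steering to y is a condition on the end point of that
solution. *)
Lemma steersP x y u : {within `[0, 1], continuous u} ->
  steers A B u x y <-> mx_integral 0 1 (forced 1 u) = y - Phi 1 0 *m x.
Proof.
move=> cu; have [Phi00 _ _] := Phi_transition m0.
have traj0 : trajectory x u 0 = x.
  by rewrite /trajectory Phi00 mul1mx mx_integral0 addr0.
split=> [[z [cz dz z0 z1]]|Iy]; last first.
  exists (trajectory x u); split=> //.
  - exact: trajectory_continuous.
  - by move=> t t01; exact: trajectory_is_derive.
  - by rewrite trajectory1// Iy addrCA subrr addr0.
have : trajectory x u 1 = z 1.
  apply: (linear_ode_uniq A_bounded (s := 0) (f := fun t => B t *m u t)) => //.
  - exact: trajectory_continuous.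
  - by move=> t t01; exact: trajectory_is_derive.
  - by rewrite traj0.
by rewrite trajectory1// z1 => <-; rewrite [Phi 1 0 *m x + _]addrC addrK.
Qed.

Lemma gramianE : gramian B Phi 1 0 =
  mx_integral 0 1 (fun t => (Phi 1 t *m B t) *m (Phi 1 t *m B t)^T).
Proof.
apply/matrixP => i j; rewrite !mxE; apply: eq_Rintegral => t _.
by rewrite trmx_mul !mulmxA.
Qed.

Lemma fine_energy (u : R -> 'cV[R]_m) : {within `[0, 1], continuous u} ->
  (energy u < +oo)%E /\
  fine (energy u) = \int[mu]_(t in `[0, 1]) (((u t)^T *m u t) ord0 ord0).
Proof.
move=> cu; have cuij i j := (continuous_mxP (from_subspace _ u)).1 cu i j.
have cu2 : {within `[0, 1], continuous (fun t => \sum_(i < m) u t i ord0 ^+ 2)}.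
  apply: continuous_sumf => i _.
  apply: (@subspace_eq_continuous _ _ _ (fun t => u t i ord0 * u t i ord0)) => //.
  by move=> x; apply: cvgM; exact: cuij.
split.
  have /integrable_fin_num := continuous_itv_integrable cu2.
  by move=> /(_ (measurable_itv _)); rewrite fin_num_abs => /(le_lt_trans (lee_abs _)).
by apply: eq_Rintegral => t _; rewrite mxE; apply: eq_bigr => i _; rewrite mxE expr2.
Qed.

(** The controls that minimize the energy are of this form, with p the Lagrange
multiplier of the end point constraint. *)
Definition optimal_control (p : 'cV[R]_n) (t : R) : 'cV[R]_m := (Phi 1 t *m B t)^T *m p.

Lemma optimal_control_continuous p : {within `[0, 1], continuous (optimal_control p)}.
Proof.
apply: (@continuous_mulmx R (subspace `[(0 : R), 1]) _ _ _ _ (fun=> p)); last first.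
  by move=> x; exact: cvg_cst.
apply: (@continuous_trmx R (subspace `[(0 : R), 1])).
apply: (@continuous_mulmx R (subspace `[(0 : R), 1])) => //.
exact: (transition_continuous_snd A_bounded Phi_transition).
Qed.

(** On the controls optimal_control p the end point map acts as the Gramian,
which is why p = M^-1 d is the right multiplier. *)
Lemma forced_optimal_control p :
  mx_integral 0 1 (forced 1 (optimal_control p)) = gramian B Phi 1 0 *m p.
Proof.
have cPB : {within `[0, 1], continuous (fun t => Phi 1 t *m B t)}.
  apply: (@continuous_mulmx R (subspace `[(0 : R), 1])) => //.
  exact: (transition_continuous_snd A_bounded Phi_transition).
rewrite gramianE -mx_integral_mulr; last first.
  apply: (@continuous_mulmx R (subspace `[(0 : R), 1])) => //.
  exact: (@continuous_trmx R (subspace `[(0 : R), 1])).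
by congr mx_integral; apply/funext => t; rewrite /forced /optimal_control mulmxA.
Qed.

(** The inner product with optimal_control p depends on u only through its end
point contribution, so it is the same for all controls that steer x to y. *)
Lemma Rintegral_optimal_control p u : {within `[0, 1], continuous u} ->
  \int[mu]_(t in `[0, 1]) (((optimal_control p t)^T *m u t) ord0 ord0) =
  (p^T *m mx_integral 0 1 (forced 1 u)) ord0 ord0.
Proof.
move=> cu; rewrite -mx_integral_mull; last exact: forced_continuous.
rewrite mxE; apply: eq_Rintegral => t _.
by rewrite /optimal_control /forced trmx_mul trmxK !mulmxA.
Qed.

Hypothesis controllable : uniformly_controllable B Phi.
Local Notation M := (gramian B Phi 1 0).

Lemma posdef_unit (N : 'M[R]_n) : posdef N -> N \in unitmx.
Proof.
move=> [_ Npos]; rewrite -row_free_unit -kermx_eq0; apply/negPn/negP => /rowV0Pn[v].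
move=> /sub_kermxP vN v0; have /Npos : v^T != 0 by rewrite trmx_eq0.
by rewrite trmxK vN mul0mx mxE ltxx.
Qed.

Lemma gramian_posdef : posdef M.
Proof. exact: controllable. Qed.

Lemma continuous_dot (u v : R -> 'cV[R]_m) :
  {within `[0, 1], continuous u} -> {within `[0, 1], continuous v} ->
  {within `[0, 1], continuous (fun t => ((u t)^T *m v t) ord0 ord0)}.
Proof.
move=> cu cv.
apply: ((continuous_mxP (from_subspace _ (fun t => (u t)^T *m v t))).1).
apply: (@continuous_mulmx R (subspace `[(0 : R), 1])) => //.
exact: (@continuous_trmx R (subspace `[(0 : R), 1])).
Qed.

(** The control with multiplier p = M^-1 d steers x to y with energy p^T d.  For any
other control u the pointwise bound |u|^2 >= 2 u* . u - |u*|^2 suffices, because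
the integral of u* . u depends on u only through the end point and is p^T d too. *)
Lemma min_energyE x y : min_energy A B x y =
  ((y - Phi 1 0 *m x)^T *m invmx M *m (y - Phi 1 0 *m x)) ord0 ord0.
Proof.
have [Msym _] := gramian_posdef; have Mu := posdef_unit gramian_posdef.
set d := y - Phi 1 0 *m x; pose p := invmx M *m d.
have pM : M *m p = d by rewrite /p mulmxA mulmxV// mul1mx.
have pd : p^T *m d = d^T *m invmx M *m d by rewrite trmx_mul trmx_inv Msym.
have cp := @optimal_control_continuous p.
have Ip : mx_integral 0 1 (forced 1 (optimal_control p)) = d by rewrite forced_optimal_control.
have Ep : fine (energy (optimal_control p)) = (d^T *m invmx M *m d) ord0 ord0.
  by rewrite (fine_energy cp).2 Rintegral_optimal_control// Ip pd.
rewrite /min_energy /min_set; set S := [set _ | _ in _].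
have Sp : S ((d^T *m invmx M *m d) ord0 ord0).
  exists (optimal_control p) => //; split; first by split=> //; exact: (fine_energy cp).1.
  exact/steersP.
have Sle : lbound S ((d^T *m invmx M *m d) ord0 ord0).
  move=> _ [u [[cu _] /(steersP _ _ cu) Iu] <-].
  rewrite (fine_energy cu).2.
  set e := _ ord0 ord0.
  have c2pu : {within `[0, 1],
      continuous (fun t => 2 * ((optimal_control p t)^T *m u t) ord0 ord0)}.
    by move=> z; apply: cvgM; [exact: cvg_cst|exact: continuous_dot].
  have ue : \int[mu]_(t in `[0, 1]) (((optimal_control p t)^T *m u t) ord0 ord0) = e.
    by rewrite Rintegral_optimal_control// Iu pd.
  have pe : \int[mu]_(t in `[0, 1])
      (((optimal_control p t)^T *m optimal_control p t) ord0 ord0) = e.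
    by rewrite Rintegral_optimal_control// Ip pd.
  have -> : e = \int[mu]_(t in `[0, 1])
     (2 * ((optimal_control p t)^T *m u t) ord0 ord0 -
      ((optimal_control p t)^T *m optimal_control p t) ord0 ord0).
    rewrite RintegralB//; last 2 first.
    - exact/continuous_itv_integrable/c2pu.
    - exact/continuous_itv_integrable/continuous_dot.
    rewrite RintegralZl//; last exact/continuous_itv_integrable/continuous_dot.
    by rewrite ue pe mulr2n mulrDl !mul1r addrK.
  apply: le_Rintegral => //.
  - apply: continuous_itv_integrable => z.
    by apply: cvgB; [exact: c2pu|exact: continuous_dot].
  - exact/continuous_itv_integrable/continuous_dot.
  move=> t _; move: (optimal_control p t) (u t) => a b.
  rewrite !mxE mulr_sumr -sumrB; apply: ler_sum => i _; rewrite !mxE.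
  (* 2 a . b - |a|^2 <= |b|^2, entry by entry. *)
  have := sqr_ge0 (a i ord0 - b i ord0); nra.
apply/xget_unique; first by split.
by move=> e [Se Sle']; apply/eqP; rewrite eq_le Sle'//= Sle.
Qed.

End min_energy_quadratic.

(** * Borel sets and Lebesgue-null hyperplanes *)

Section borel_cV.
Variables (R : realType) (p q : nat).

Lemma open_measurable_mx (U : set 'M[R]_(p, q)) : open U -> measurable U.
Proof. by move=> oU; exact: sub_sigma_algebra. Qed.

Lemma closed_measurable_mx (U : set 'M[R]_(p, q)) : closed U -> measurable U.
Proof.
move=> cU; rewrite -[U]setCK; apply: measurableC; apply: open_measurable_mx.
exact: closed_openC.
Qed.

Lemma measurable_set1_mx (M : 'M[R]_(p, q)) : measurable [set M].
Proof.
apply: closed_measurable_mx; apply: accessible_closed_set1.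
exact: hausdorff_accessible (@norm_hausdorff R _).
Qed.

Lemma compact_measurable_mx (U : set 'M[R]_(p, q)) : compact U -> measurable U.
Proof.
move=> cU; apply: closed_measurable_mx; apply: compact_closed cU.
exact: (@norm_hausdorff R _).
Qed.

Lemma continuous_measurable_mx (f : 'M[R]_(p, q) -> R) :
  continuous f -> measurable_fun setT f.
Proof.
move=> /continuousP cf; apply: (measurability _ (RGenOpens.measurableE R)).
move=> _ [_ [a [b ->] <-]]; rewrite setTI; apply: open_measurable_mx.
exact/cf/interval_open.
Qed.

End borel_cV.

Section hyperplane.
Variable R : realType.
Local Notation mR := (measurableTypeR R).

Let plane n (a : 'I_n -> R) (b : R) : set (n.-tuple mR) :=
  [set t | \sum_i a i * tnth t i = b].

(** Slicing along the first coordinate: if some later coefficient is nonzero,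
every slice is a hyperplane and null by induction; otherwise only one slice is
nonempty, and a single point is null on the line. *)
Let plane_null n (a : 'I_n -> R) b : (exists i, a i != 0) ->
  lebesgue_tuple R n (plane a b) = 0%E.
Proof.
elim: n => [|n IH] in a b *; first by move=> [[]].
move=> a0.
pose a' i := a (lift ord0 i).
rewrite [LHS]/= /lebesgue_tuple_step /pushforward/=.
rewrite /product_measure1/=.
have sec x : xsection (tuple_cons (n := n) @^-1` plane a b) x = plane a' (b - a ord0 * x).
  have cons0 (t : n.-tuple mR) : tnth (tuple_cons (x, t)) ord0 = x.
    by rewrite (tnth_nth x).
  have consS (t : n.-tuple mR) i : tnth (tuple_cons (x, t)) (lift ord0 i) = tnth t i.
    by rewrite !(tnth_nth x).
  have sum_cons t : \sum_i a i * tnth (tuple_cons (x, t)) i =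
      a ord0 * x + \sum_i a' i * tnth t i.
    by rewrite big_ord_recl cons0; under eq_bigr do rewrite consS.
  apply/seteqP; split => t; rewrite /xsection/= inE/= /plane/= sum_cons => h.
    by rewrite -h [a _ * _ + _]addrC addrK.
  by rewrite h addrC subrK.
under eq_integral do rewrite sec.
have [[i ai]|a'0] := pselect (exists i, a' i != 0).
  by apply: integral0_eq => x _; apply: IH; exists i.
have {}a'0 i : a' i = 0.
  by apply/eqP/negP => /negP ai; apply: a'0; exists i.
have a00 : a ord0 != 0.
  by case: a0 => i; case: (unliftP ord0 i) => [j ->|->//]; rewrite [a _]a'0 eqxx.
rewrite -(integral_set1 (fun x => lebesgue_tuple R n (plane a' (b - a ord0 * x))) (b / a ord0)).
rewrite [RHS]integral_mkcond; apply: eq_integral => x _.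
rewrite patchE; case: ifPn => //; rewrite notin_setE/= => xb.
rewrite (_ : plane _ _ = set0) ?measure0// -subset0 => t; rewrite /plane/=.
under eq_bigr do rewrite a'0 mul0r.
by rewrite big1// => h; apply: xb; rewrite -[b](subrK (a ord0 * x)) -h add0r [a _ * x]mulrC mulfK.
Qed.

Lemma lebesgue_hyperplane n (a : 'cV[R]_n) (b : R) : a != 0 ->
  lebesgue_cV [set x : 'cV[R]_n | (a^T *m x) ord0 ord0 = b] = 0%E.
Proof.
move=> a0; rewrite /lebesgue_cV /pushforward.
rewrite (_ : _ @^-1` _ = plane (fun i => a i ord0) b).
  apply: plane_null; apply/existsP; move: a0; apply: contraNT.
  rewrite negb_exists => /forallP a0; apply/eqP/matrixP => i j.
  by rewrite mxE ord1; apply/eqP; have := a0 i; rewrite negbK.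
apply/seteqP; split=> t; rewrite /plane/= mxE => <-; apply: eq_bigr => i _; by rewrite !mxE.
Qed.

End hyperplane.

Lemma hyperplane_measurable (R : realType) n (a : 'cV[R]_n) (b : R) :
  measurable [set x : 'cV[R]_n | (a^T *m x) ord0 ord0 = b].
Proof.
have ca : continuous (fun x : 'cV[R]_n => (a^T *m x) ord0 ord0).
  apply: (continuous_mxP (fun x : 'cV[R]_n => a^T *m x)).1.
  apply: (@continuous_mulmx R 'cV[R]_n _ _ _ (fun=> a^T) id); first exact: cst_continuous.
  by move=> x; exact: cvg_id.
rewrite -[X in measurable X]setTI.
exact: (continuous_measurable_mx ca measurableT (measurable_set1 b)).
Qed.

(** * Existence of a potential with prescribed cell masses *)

(** Lets ties between cells be ignored when masses are compared. *)
Lemma le_measure_ae d (T : measurableType d) (R : realType)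
    (mu : {measure set T -> \bar R}) (A B : set T) :
  measurable A -> measurable B -> {ae mu, forall x, A x -> B x} ->
  (mu A <= mu B)%E.
Proof.
move=> mA mB [N [mN N0 AB]]; rewrite -(measureU0 mB mN N0).
apply: le_measure; rewrite ?inE//; first exact: measurableU.
by move=> x Ax; have [Bx|nBx] := pselect (B x); [left|right; apply: AB => /(_ Ax)].
Qed.

Section bisector.
Variables (R : realType) (n r : nat) (X : set 'cV[R]_n).
Variables (c : 'cV[R]_n -> 'cV[R]_n -> R) (y : 'I_r -> 'cV[R]_n).
Hypothesis X_measurable : measurable X.
Hypothesis c_measurable : forall i, measurable_fun setT (c^~ (y i)).

Definition bisector i j (k : R) : set 'cV[R]_n :=
  X `&` [set x | c x (y i) - c x (y j) = k].

Lemma bisector_measurable i j k : measurable (bisector i j k).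
Proof.
apply: measurableI => //; rewrite -[X in measurable X]setTI.
exact: (measurable_funB (c_measurable i) (c_measurable j) measurableT
  (measurable_set1 k)).
Qed.

End bisector.

Section semidiscrete_duality.
Variables (R : realType) (n r : nat) (i0 : 'I_r).
Variables (X : set 'cV[R]_n) (mu : probability 'cV[R]_n R).
Variables (c : 'cV[R]_n -> 'cV[R]_n -> R) (y : 'I_r -> 'cV[R]_n) (D : R).
Hypothesis X_measurable : measurable X.
Hypothesis X_full : mu X = 1%E.
Hypothesis c_measurable : forall i, measurable_fun setT (c^~ (y i)).
Hypothesis c_bounded : forall i x, X x -> 0 <= c x (y i) <= D.
Hypothesis ties_null : forall i j k, i != j ->
  mu (bisector X c y i j k) = 0%E.
Implicit Types (psi : 'I_r -> R) (i j : 'I_r) (x : 'cV[R]_n).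

Local Notation Lag := (laguerre X c y).
Local Notation intLag := (laguerre_interior X c y).

Definition score psi i x : R := c x (y i) + psi i.
(** The starting value score psi i0 x is itself one of the terms, so this is the
plain minimum. *)
Definition envelope psi x : R := \big[Num.min/score psi i0 x]_(i < r) score psi i x.

Lemma envelope_le psi i x : envelope psi x <= score psi i x.
Proof. exact: bigmin_le. Qed.

Lemma le_envelope psi x k : (forall i, k <= score psi i x) -> k <= envelope psi x.
Proof. by move=> h; apply: le_bigmin. Qed.

Lemma envelope_attained psi x : exists i, envelope psi x = score psi i x.
Proof.
apply: contrapT => /forallNP h.
suff : envelope psi x < envelope psi x by rewrite ltxx.
have lt i : envelope psi x < score psi i x.
  by rewrite lt_neqAle envelope_le andbT; apply/eqP/h.
by rewrite {2}/envelope; elim/big_ind : _ => // a b ha hb; rewrite lt_min ha hb.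
Qed.

Lemma laguerreP psi i x : Lag psi i x <-> X x /\ envelope psi x = score psi i x.
Proof.
split=> [[Xx Li]|[Xx ei]]; split => //.
  apply: le_anti; rewrite envelope_le le_envelope// => j.
  by have [->//|ji] := eqVneq j i; exact: Li.
by move=> j _; rewrite -/(score psi i x) -/(score psi j x) -ei envelope_le.
Qed.

Lemma laguerre_interior_envelope psi i j x : intLag psi i x ->
  envelope psi x = score psi j x -> j = i.
Proof.
move=> [Xx Li] ej; apply: contrapT => /eqP ji; have := Li j ji.
by rewrite -/(score psi i x) -/(score psi j x) -ej ltNge envelope_le.
Qed.

Lemma laguerre_interior_sub psi i : intLag psi i `<=` Lag psi i.
Proof. by move=> x [Xx Li]; split=> // j ji; exact/ltW/Li. Qed.

Lemma laguerre_interior_inj psi i j x : intLag psi i x -> intLag psi j x -> i = j.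
Proof.
move=> Li /laguerre_interior_sub/laguerreP[_ ej].
by rewrite (laguerre_interior_envelope Li ej).
Qed.

Lemma score_measurable psi i : measurable_fun setT (score psi i).
Proof. by apply: measurable_funD => //; exact: c_measurable. Qed.

Lemma envelope_measurable psi : measurable_fun setT (envelope psi).
Proof.
rewrite /envelope; elim: (index_enum _) => [|i s IH].
  by under eq_fun do rewrite big_nil; exact: score_measurable.
under eq_fun do rewrite big_cons.
by apply: measurable_minr => //; exact: score_measurable.
Qed.

Lemma laguerre_measurable psi i : measurable (Lag psi i).
Proof.
rewrite (_ : Lag psi i = X `&` [set x | envelope psi x = score psi i x]); last first.
  by apply/seteqP; split => x; rewrite /= laguerreP.
apply: measurableI => //; rewrite -[X in measurable X]setTI.
have := measurable_fun_eqr (envelope_measurable psi) (score_measurable psi i).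
move=> /(_ measurableT [set true] I).
by congr measurable; apply/seteqP; split=> x /= [_ /eqP].
Qed.

Lemma laguerre_interior_measurable psi i : measurable (intLag psi i).
Proof.
rewrite (_ : intLag psi i = X `&`
    \bigcap_(j in [set j | j != i]) [set x | score psi i x < score psi j x]); last first.
  by apply/seteqP; split => x [Xx h]; split.
apply: measurableI => //; apply: fin_bigcap_measurable => [|j _]; first exact: finite_finset.
rewrite -[X in measurable X]setTI.
have := measurable_fun_ltr (score_measurable psi i) (score_measurable psi j).
by move=> /(_ measurableT [set true] I).
Qed.

(** A point of X outside all strict cells has two minimal scores, so it lies on
one of finitely many bisectors. *)
Lemma ae_laguerre_interior psi : {ae mu, forall x, X x -> exists i, intLag psi i x}.
Proof.
have : {ae mu, forall x, forall ij : 'I_r * 'I_r,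
    X x -> ij.1 != ij.2 -> c x (y ij.1) - c x (y ij.2) != psi ij.2 - psi ij.1}.
  apply: filter_forall => -[i j]/=.
  have [->|ij] := eqVneq i j; first exact: aeW.
  exists (bisector X c y i j (psi j - psi i)); split.
  - exact: bisector_measurable.
  - exact: ties_null.
  - move=> x /= /not_implyP[Xx /not_implyP[_ /negP]]; rewrite negbK => /eqP h; split=> //.
apply: filterS => x ne Xx; have [i ei] := envelope_attained psi x.
exists i; split => // j ji; rewrite -/(score psi i x) -/(score psi j x).
rewrite lt_neqAle -ei envelope_le andbT ei.
apply: contraNneq (ne (i, j) Xx _) => [|/=]; last by rewrite eq_sym.
rewrite /score/= => h; apply/eqP; lra.
Qed.

Lemma laguerre_interior_measure psi i : mu (intLag psi i) = mu (Lag psi i).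
Proof.
apply/eqP; rewrite eq_le; apply/andP; split.
  by apply: le_measure; rewrite ?inE;
    [exact: laguerre_interior_measurable|exact: laguerre_measurable|
     exact: laguerre_interior_sub].
apply: le_measure_ae; [exact: laguerre_measurable|exact: laguerre_interior_measurable|].
apply: filterS (ae_laguerre_interior psi) => x h /laguerreP[/h[j Lj] ei].
by rewrite (laguerre_interior_envelope Lj ei).
Qed.

Lemma bounded_integrable (f : 'cV[R]_n -> R) (K : R) :
  measurable_fun X f -> (forall x, X x -> `|f x| <= K) ->
  mu.-integrable X (EFin \o f).
Proof.
move=> mf fK; apply: measurable_bounded_integrable => //.
  exact: le_lt_trans (probability_le1 mu X_measurable) (ltry 1).
by exists K; split; rewrite ?num_real// => k Kk x Xx; apply: le_trans (fK x Xx) (ltW Kk).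
Qed.

Lemma envelope_integrable psi : mu.-integrable X (EFin \o envelope psi).
Proof.
apply: (@bounded_integrable _ (D + \sum_i `|psi i|)).
  by apply: measurable_funS (envelope_measurable psi).
move=> x Xx; have [i ->] := envelope_attained psi x.
have /andP[c0 cD] := c_bounded i Xx.
apply: le_trans (ler_normD _ _) _; apply: lerD; first by rewrite ger0_norm.
by rewrite (bigD1 i)//= lerDl sumr_ge0.
Qed.

Lemma Rintegral_cst_X (k : R) : \int[mu]_(x in X) k = k.
Proof.
by rewrite Rintegral_cst// -[RHS]mulr1; congr (_ * _); exact: (congr1 fine X_full).
Qed.

Lemma cst_integrable (k : R) : mu.-integrable X (EFin \o (fun=> k)).
Proof. by apply: (@bounded_integrable _ `|k|) => //; exact: measurable_cst. Qed.

Lemma le_envelope_add psi psi' d x : (forall i, psi' i <= psi i + d) ->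
  envelope psi' x <= envelope psi x + d.
Proof.
move=> h; have [i ->] := envelope_attained psi x.
by rewrite (le_trans (envelope_le psi' i x))// /score -addrA lerD2l.
Qed.

Variable nu : 'I_r -> R.
Hypothesis nu_simplex : in_simplex nu.

(** The objective of the Kantorovich dual problem. *)
Definition dual psi : R := \int[mu]_(x in X) envelope psi x - \sum_i nu i * psi i.

Lemma le_dual_add psi psi' d d' :
  (forall i, psi' i <= psi i + d) -> (forall i, psi i <= psi' i + d') ->
  dual psi' <= dual psi + (d + d').
Proof.
move=> h h'; have [nu0 nu1] := nu_simplex.
have H1 : \int[mu]_(x in X) envelope psi' x <= \int[mu]_(x in X) envelope psi x + d.
  rewrite -[d]Rintegral_cst_X -RintegralD//; last 2 first.
  - exact: envelope_integrable.
  - exact: cst_integrable.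
  apply: le_Rintegral => //; first exact: envelope_integrable.
  - exact: (integrableD X_measurable (envelope_integrable psi) (cst_integrable d)).
  - by move=> x _; exact: le_envelope_add.
have H2 : \sum_i nu i * psi i <= \sum_i nu i * psi' i + d'.
  rewrite -[d']mul1r -{1}nu1 mulr_suml -big_split/=; apply: ler_sum => i _.
  by rewrite -mulrDr ler_wpM2l.
rewrite /dual; lra.
Qed.

(** Adding k to the potential adds k to the envelope and, as nu has mass 1, also
k to the linear term. *)
Lemma dual_shift psi k : dual (fun i => psi i + k) = dual psi.
Proof.
apply: le_anti; apply/andP; split; rewrite -[leRHS]addr0.
- by rewrite -(subrr k); apply: le_dual_add => i //; rewrite addrK.
- by rewrite -(subrr (- k)) opprK; apply: le_dual_add => i //; rewrite addrK.
Qed.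

Lemma dual_continuous : continuous (fun v : 'rV[R]_r => dual (v ord0)).
Proof.
move=> v; have Fv : Filter (nbhs v) by exact: nbhs_filter.
apply/cvgrPdist_le => /= e e0; near=> w.
have vw : `|v - w| < e / 2.
  near: w; apply/(@nbhs_ballP R 'rV[R]_r v); exists (e / 2); first by rewrite /= divr_gt0.
  by rewrite mx_norm_ball => w.
have vwi i : `|v ord0 i - w ord0 i| <= e / 2.
  apply: le_trans (ltW vw); rewrite [leRHS]/Num.Def.normr/= mx_normrE.
  have := le_bigmax 0 (fun ij : 'I_1 * 'I_r => `|(v - w) ij.1 ij.2|) (ord0, i).
  by rewrite !mxE.
have h1 i : v ord0 i <= w ord0 i + e / 2.
  by have := vwi i; rewrite ler_norml => /andP[_]; rewrite lerBlDl.
have h2 i : w ord0 i <= v ord0 i + e / 2.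
  by have := vwi i; rewrite distrC ler_norml => /andP[_]; rewrite lerBlDl.
have := le_dual_add h1 h2; have := le_dual_add h2 h1.
rewrite -splitr ler_norml; lra.
Unshelve. all: by end_near. Qed.

Lemma dual_box_max (b : R) : 0 <= b -> exists2 psi : 'I_r -> R,
  (forall i, 0 <= psi i <= b) &
  forall psi', (forall i, 0 <= psi' i <= b) -> dual psi' <= dual psi.
Proof.
move=> b0.
have cbox := @rV_compact R r (fun=> `[0, b]%classic) (fun=> @segment_compact R 0 b).
have box0 : [set v : 'rV[R]_r | forall i, `[0, b]%classic (v ord0 i)] !=set0.
  by exists 0 => i; rewrite /= mxE in_itv/= lexx.
have [v] := EVT_max_rV box0 cbox (continuous_subspaceT dual_continuous).
rewrite inE/= => vb vmax; exists (v ord0) => [i|psi psib].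
  by have := vb i; rewrite in_itv.
have := vmax (\row_i psi i); rewrite inE/=.
rewrite (_ : (\row_i psi i) ord0 = psi); first by apply => i; rewrite in_itv/=.
by apply/funext => i; rewrite mxE.
Qed.

(** A maximizer on the box stays in the box, and stays a maximizer, once its least
coordinate has been subtracted. *)
Lemma dual_max_min0 (b : R) : 0 <= b -> exists psi : 'I_r -> R,
  [/\ forall i, 0 <= psi i <= b, exists j, psi j = 0 &
  forall psi', (forall i, 0 <= psi' i <= b) -> dual psi' <= dual psi].
Proof.
move=> /dual_box_max[psi psib psimax].
have [j jmin] : exists j, forall i, psi j <= psi i.
  by exists [arg min_(i < i0) psi i]%O; case: arg_minP => // j _ h i; exact: h.
exists (fun i => psi i - psi j); split; last by move=> psi' h; rewrite dual_shift psimax.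
- move=> i; rewrite subr_ge0 jmin/=; have := psib i; have := psib j; lra.
- by exists j; rewrite subrr.
Qed.

Definition bump psi i (e : R) : 'I_r -> R := fun j => psi j + (if j == i then e else 0).

(** The envelope never decreases when psi i is raised by e, and on the new cell of
i, where i is still optimal, it rises by the full amount e. *)
Lemma dual_bump psi i (e : R) : 0 <= e ->
  dual psi + e * (fine (mu (Lag (bump psi i e) i)) - nu i) <= dual (bump psi i e).
Proof.
move=> e0; set psi' := bump psi i e; set L := Lag psi' i.
have mL : measurable L by exact: laguerre_measurable.
have LX : L `<=` X by move=> x [].
have IL : \int[mu]_(x in X) \1_L x = fine (mu L).
  by rewrite /Rintegral integral_indic// setIidl.
have iL : mu.-integrable X (EFin \o \1_L).
  apply: (@bounded_integrable _ 1) => [|x _]; first exact: measurable_indic.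
  by rewrite indicE; case: (_ \in _); rewrite ?normr1 ?normr0.
have ieL : mu.-integrable X (EFin \o (fun x => e * \1_L x)).
  apply: (@bounded_integrable _ e) => [|x _]; last first.
    by rewrite indicE; case: (_ \in _); rewrite ?mulr1 ?mulr0 ?normr0 // ger0_norm.
  by apply: measurable_funM => //; exact: measurable_indic.
have sum_bump : \sum_j nu j * psi' j = \sum_j nu j * psi j + nu i * e.
  rewrite /psi' /bump; under eq_bigr do rewrite mulrDr.
  rewrite big_split/=; congr (_ + _); rewrite (bigD1 i)//= eqxx big1 ?addr0// => j /negbTE ->.
  by rewrite mulr0.
have H : \int[mu]_(x in X) (envelope psi x + e * \1_L x) <= \int[mu]_(x in X) envelope psi' x.
  apply: le_Rintegral => //; last 1 first.
  - move=> x Xx; rewrite indicE; have [/[!inE] /laguerreP[_ ->]|_] := boolP (_ \in _).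
      rewrite mulr1 /score /psi' /bump eqxx addrA lerD2r.
      exact: envelope_le.
    rewrite mulr0 addr0; apply: le_envelope => j; apply: le_trans (envelope_le _ j _) _.
    by rewrite /score lerD2l /psi' /bump lerDl; case: ifP.
  - exact: (integrableD X_measurable (envelope_integrable psi) ieL).
  - exact: envelope_integrable.
move: H; rewrite RintegralD//; last exact: envelope_integrable.
rewrite RintegralZl// IL /dual sum_bump; lra.
Qed.

(** As the bump shrinks, the cells of the bumped potentials exhaust the strict
cell, which has room to spare at each of its points. *)
Lemma laguerre_interior_bump psi i (b : R) : 0 < b ->
  intLag psi i = \bigcup_k Lag (bump psi i (b / k.+1%:R)) i.
Proof.
move=> b0; apply/seteqP; split=> x; last first.
  move=> [k _ [Xx Li]]; split=> // j ji; have := Li j ji.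
  rewrite /bump eqxx (negbTE ji) addr0; apply: lt_le_trans.
  by rewrite addrA ltrDl divr_gt0.
move=> [Xx Li].
(* The smallest margin by which i beats the other indices at x. *)
pose m := \big[Num.min/b]_(j | j != i) (score psi j x - score psi i x).
have m0 : 0 < m.
  rewrite /m; elim/big_ind : _ => // [a a' ha ha'|j ji]; first by rewrite lt_min ha ha'.
  by rewrite subr_gt0; exact: Li.
have mj j : j != i -> m <= score psi j x - score psi i x by move=> ji; exact: bigmin_le_cond.
exists (Num.truncn (b / m)) => //; split => // j ji; rewrite /bump eqxx (negbTE ji) addr0.
have km : b / (Num.truncn (b / m)).+1%:R <= m.
  by rewrite ler_pdivrMr// mulrC -ler_pdivrMr// ltW// truncnS_gt.
have := mj j ji; rewrite /score; move: (b / _) km => z km; lra.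
Qed.

(** One-sided optimality at a maximizer with least coordinate 0: while psi i is
below the top of the box it can be raised, so dual_bump bounds the masses of the
bumped cells by nu i, and these cells exhaust the strict cell; when psi i is at
the top, the cell is empty. *)
Lemma exists_dominated_potential : exists psi, forall i, (mu (intLag psi i) <= (nu i)%:E)%E.
Proof.
have [nu0 nu1] := nu_simplex.
(* Any box strictly wider than the range [0, D] of the cost would do. *)
pose b : R := `|D| + 1; have b0 : 0 < b by rewrite ltr_wpDl.
have [psi [psib [j0 psij0] psimax]] := dual_max_min0 (ltW b0).
exists psi => i; have := psib i => /andP[psi0]; rewrite le_eqVlt => /predU1P[psi_b|psi_b].
  rewrite (_ : intLag psi i = set0) ?measure0 ?lee_fin// -subset0 => x [Xx].
  (* At the top of the box: i is dearer than j0 by more than the cost can repay, so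
     its cell is empty. *)
  have ij : j0 != i by apply: contraTneq b0 => j0i; rewrite -psi_b -j0i psij0 ltxx.
  move=> /(_ j0 ij); rewrite psij0 psi_b addr0 /b => h.
  have /andP[] := c_bounded i Xx; have /andP[] := c_bounded j0 Xx.
  have := ler_norm D; lra.
pose e := b - psi i; have e0 : 0 < e by rewrite subr_gt0.
have ek k : 0 < e / k.+1%:R <= e.
  by rewrite divr_gt0//= ler_pdivrMr// ler_peMr ?ler1n// ltW.
rewrite (laguerre_interior_bump psi i e0).
have mL k : measurable (Lag (bump psi i (e / k.+1%:R)) i) by exact: laguerre_measurable.
apply: (cvge_to_le (nondecreasing_cvg_mu mL (bigcup_measurable (fun k _ => mL k)) _)).
  move=> k l kl; apply/subsetPset => x [Xx h]; split=> // j ji; have := h j ji.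
  rewrite /bump eqxx (negbTE ji) addr0; apply: le_trans.
  rewrite lerD2l lerD2l ler_pM2l// lef_pV2 ?posrE//.
  by rewrite ler_nat ltnS.
apply: nearW => k /=.
have /andP[ek0 eke] := ek k.
have := @dual_bump psi i _ (ltW ek0).
have : dual (bump psi i (e / k.+1%:R)) <= dual psi.
  apply: psimax => j; rewrite /bump; case: eqP => [->|_]; last by rewrite addr0.
  rewrite addr_ge0 ?(ltW ek0)//=; move: eke; move: (e / _) => z; rewrite /e; lra.
move=> h1 h2; have h3 := le_trans h2 h1.
rewrite -[mu _]fineK ?(fin_num_measure mu _ (mL k))//.
by move: h3; rewrite gerDl pmulr_rle0// subr_le0 lee_fin.
Qed.

Lemma measure_laguerre_interior_bigcup psi (P : {pred 'I_r}) :
  mu (\bigcup_(i in [set` P]) intLag psi i) = (\sum_(i in P) mu (intLag psi i))%E.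
Proof.
rewrite bigcup_pred; apply: measure_bigsetU_ord => [i|].
  exact: laguerre_interior_measurable.
apply/trivIsetP => i j _ _ ij; rewrite -subset0 => x [Li Lj].
by move: ij; rewrite (laguerre_interior_inj Li Lj) eqxx.
Qed.

Lemma bigcup_laguerre_interior_measurable psi (P : set 'I_r) :
  measurable (\bigcup_(i in P) intLag psi i).
Proof.
apply: fin_bigcup_measurable => [|i _]; first exact: finite_finset.
exact: laguerre_interior_measurable.
Qed.

(** The cells cover X up to a null set, so their masses sum to at least 1, while
each is dominated by nu i and the nu i sum to 1. *)
Lemma exists_laguerre_potential : exists psi, forall i, mu (intLag psi i) = (nu i)%:E.
Proof.
have [nu0 nu1] := nu_simplex.
have [psi psi_le] := exists_dominated_potential; exists psi.
have mL i : measurable (intLag psi i) by exact: laguerre_interior_measurable.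
pose G i := fine (mu (intLag psi i)).
have GE i : mu (intLag psi i) = (G i)%:E by rewrite fineK// fin_num_measure.
have Gnu i : G i <= nu i by rewrite -lee_fin -GE.
have sumG : 1 <= \sum_i G i.
  rewrite -lee_fin -sumEFin; under eq_bigr do rewrite -GE.
  rewrite -(measure_laguerre_interior_bigcup psi predT) -X_full.
  apply: le_measure_ae => //; first exact: bigcup_laguerre_interior_measurable.
  by apply: filterS (ae_laguerre_interior psi) => x h /h[i Li]; exists i.
have sum0 : \sum_i (nu i - G i) = 0.
  apply/eqP; rewrite eq_le sumr_ge0 ?andbT; last by move=> i _; rewrite subr_ge0.
  by rewrite sumrB nu1 subr_le0.
move=> i; rewrite GE; congr EFin; apply/esym/eqP; rewrite -subr_eq0; apply/eqP.
by apply: (psumr_eq0P _ sum0) => // j _; rewrite subr_ge0.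
Qed.

(** * Optimality and uniqueness of the Laguerre map *)

Section laguerre_transport.
Hypothesis y_inj : injective y.
Variable psi : 'I_r -> R.
Hypothesis psi_mass : forall i, mu (intLag psi i) = (nu i)%:E.

(** The strict cells cover X up to a null set; elsewhere the value y i0 is
arbitrary. *)
Definition laguerre_map x : 'cV[R]_n := y (odflt i0 [pick i | `[< intLag psi i x >]]).

Lemma laguerre_mapE i x : intLag psi i x -> laguerre_map x = y i.
Proof.
move=> Li; rewrite /laguerre_map; case: pickP => [j /asboolP Lj|/(_ i)].
  by rewrite /= (laguerre_interior_inj Lj Li).
by rewrite asboolT.
Qed.

Lemma laguerre_map_measurable : measurable_fun X laguerre_map.
Proof.
move=> _ S mS; pose U := \bigcup_i intLag psi i.
have mU : measurable U by exact: bigcup_laguerre_interior_measurable.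
rewrite (_ : _ `&` _ = \bigcup_(i in [set i | S (y i)]) intLag psi i `|`
    (if `[< S (y i0) >] then X `\` U else set0)); last first.
  apply/seteqP; split=> x.
    move=> [Xx]; rewrite /preimage/= /laguerre_map; case: pickP => [i /asboolP Li Si|noL Si0].
      by left; exists i.
    by right; rewrite asboolT//; split=> // -[i _ Li]; have := noL i; rewrite asboolT.
  move=> [[i Si Li]|]; first by split; [case: Li|rewrite /preimage/= (laguerre_mapE Li)].
  case: asboolP => // Si0 [Xx nU]; split => //; rewrite /preimage/= /laguerre_map.
  by case: pickP => [i /asboolP Li|//]; case: nU; exists i.
apply: measurableU; first exact: bigcup_laguerre_interior_measurable.
by case: asboolP => // _; exact: measurableD.
Qed.

Lemma laguerre_map_transport : transport_map X mu y nu laguerre_map.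
Proof.
split; [by move=> x _; eexists|exact: laguerre_map_measurable|move=> S mS].
have mXS := laguerre_map_measurable X_measurable mS.
pose P := [pred i | y i \in S].
transitivity (mu (\bigcup_(i in [set` P]) intLag psi i)).
  apply/eqP; rewrite eq_le; apply/andP; split; apply: le_measure_ae => //;
    do ?exact: bigcup_laguerre_interior_measurable.
    apply: filterS (ae_laguerre_interior psi) => x h [/h[i Li]].
    rewrite /preimage/= (laguerre_mapE Li) => Si; exists i => //=.
    by rewrite inE.
  apply: aeW => x [i /= Si Li]; split; first by case: Li.
  by rewrite /preimage/= (laguerre_mapE Li); move: Si; rewrite !inE.
rewrite measure_laguerre_interior_bigcup /discrete_measure big_mkcond/=.
apply: eq_bigr => i _; rewrite psi_mass diracE inE.
by case: (_ \in _); rewrite ?mule1 ?mule0.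
Qed.

(** How far T x is from being optimal for x at the prices psi; the sum reads the
price psi i off the value y i of T x. *)
Definition gap (T : 'cV[R]_n -> 'cV[R]_n) x : R :=
  c x (T x) + \sum_i psi i * (T x == y i)%:R - envelope psi x.

Lemma gapE (T : 'cV[R]_n -> 'cV[R]_n) i x : T x = y i ->
  gap T x = score psi i x - envelope psi x.
Proof.
move=> Ti; rewrite /gap Ti (bigD1 i)//= eqxx mulr1 big1 ?addr0// => j ji.
by rewrite (inj_eq y_inj) eq_sym (negbTE ji) mulr0.
Qed.

Section gap_of_transport.
Variable T : 'cV[R]_n -> 'cV[R]_n.
Hypothesis T_transport : transport_map X mu y nu T.

Lemma gap_ge0 x : X x -> 0 <= gap T x.
Proof.
move=> Xx; have [T_y _ _] := T_transport; have [i Ti] := T_y x Xx.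
by rewrite (gapE Ti) subr_ge0 envelope_le.
Qed.

Lemma transport_fiber_measurable i : measurable (X `&` T @^-1` [set y i]).
Proof.
have [_ mT _] := T_transport; apply: mT => //.
exact: measurable_set1_mx.
Qed.

Lemma transport_fiber_mass i : mu (X `&` T @^-1` [set y i]) = (nu i)%:E.
Proof.
have [_ _ mass] := T_transport; rewrite mass; last first.
  exact: measurable_set1_mx.
rewrite /discrete_measure (bigD1 i)//= diracE mem_set// mule1 big1 ?adde0// => j ji.
rewrite diracE memNset ?mule0//= => /y_inj ij; by rewrite ij eqxx in ji.
Qed.

Lemma transport_fiber_indicE i x : X x ->
  (T x == y i)%:R = \1_(X `&` T @^-1` [set y i]) x :> R.
Proof.
move=> Xx; rewrite indicE; congr (_%:R); congr nat_of_bool.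
by apply/eqP/idP => [Ti|/[!inE]-[]//]; apply/mem_set; split.
Qed.

Lemma fiber_measurable i : measurable_fun X (fun x => (T x == y i)%:R : R).
Proof.
apply: eq_measurable_fun (measurable_indic (transport_fiber_measurable i)).
by move=> x /[!inE] Xx; rewrite transport_fiber_indicE.
Qed.

Lemma transported_cost_integrable : mu.-integrable X (EFin \o (fun x => c x (T x))).
Proof.
have [T_y _ _] := T_transport; apply: (@bounded_integrable _ D); last first.
  move=> x Xx; have [i ->] := T_y x Xx; have /andP[c0 cD] := c_bounded i Xx.
  by rewrite ger0_norm.
apply: (@eq_measurable_fun _ _ _ _ _ (fun x => \sum_i c x (y i) * (T x == y i)%:R)).
  move=> x /[!inE] /T_y[i Ti]; rewrite (bigD1 i)//= Ti eqxx mulr1 big1 ?addr0// => j ji.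
  by rewrite (inj_eq y_inj) eq_sym (negbTE ji) mulr0.
apply: measurable_sum => i; apply: measurable_funM; last exact: fiber_measurable.
exact: measurable_funTS.
Qed.

Lemma potential_fiber_integrable i :
  mu.-integrable X (EFin \o (fun x => psi i * (T x == y i)%:R)).
Proof.
apply: (@bounded_integrable _ `|psi i|) => [|x _].
  by apply: measurable_funM => //; exact: fiber_measurable.
by case: eqP => _; rewrite ?mulr1 ?mulr0 ?normr0.
Qed.

Lemma potential_integrable :
  mu.-integrable X (EFin \o (fun x => \sum_i psi i * (T x == y i)%:R)).
Proof.
rewrite (_ : EFin \o _ = fun x => (\sum_i (EFin \o (fun x => (psi i * (T x == y i)%:R)%R)) x)%E).
  by apply: integrable_sum => // i _; exact: potential_fiber_integrable.
by apply/funext => x; rewrite /= sumEFin.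
Qed.

Lemma Rintegral_potential :
  \int[mu]_(x in X) (\sum_i psi i * (T x == y i)%:R) = \sum_i nu i * psi i.
Proof.
rewrite Rintegral_sum//; last exact: potential_fiber_integrable.
apply: eq_bigr => i _.
under eq_Rintegral => x /[!inE] Xx do rewrite transport_fiber_indicE//.
rewrite RintegralZl//; last first.
  apply: (@bounded_integrable _ 1) => [|x _].
    by apply: measurable_indic; exact: transport_fiber_measurable.
  by rewrite indicE; case: (_ \in _); rewrite ?normr1 ?normr0.
rewrite mulrC; congr (_ * _).
rewrite /Rintegral integral_indic//; last exact: transport_fiber_measurable.
by rewrite setIAC setIid; exact: (congr1 fine (transport_fiber_mass i)).
Qed.

Lemma cost_plus_potential_integrable :
  mu.-integrable X (EFin \o (fun x => c x (T x) + \sum_i psi i * (T x == y i)%:R)).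
Proof.
exact: (integrableD X_measurable transported_cost_integrable potential_integrable).
Qed.

Lemma gap_integrable : mu.-integrable X (EFin \o gap T).
Proof.
exact: (integrableB X_measurable cost_plus_potential_integrable (envelope_integrable psi)).
Qed.

(** The price term integrates to the pairing of nu and psi, because T has the
prescribed fiber masses; so the cost of T is the dual value plus the mean gap. *)
Lemma transport_costE :
  transport_cost X mu c T = (dual psi + \int[mu]_(x in X) gap T x)%:E.
Proof.
have ic := transported_cost_integrable.
have -> : transport_cost X mu c T = (\int[mu]_(x in X) c x (T x))%:E.
  by rewrite /Rintegral fineK//; exact: integrable_fin_num.
rewrite /gap RintegralB//; last 2 first.
- exact: cost_plus_potential_integrable.
- exact: envelope_integrable.
rewrite RintegralD//; last exact: potential_integrable.
rewrite Rintegral_potential /dual; congr EFin; ring.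
Qed.

Lemma gap_int_ge0 : 0 <= \int[mu]_(x in X) gap T x.
Proof. by apply: Rintegral_ge0 => x; exact: gap_ge0. Qed.

(** A nonnegative function with zero integral vanishes almost everywhere, and where
the gap vanishes inside the strict cell of i, only y i is left as a value. *)
Lemma gap_int_eq0 : \int[mu]_(x in X) gap T x = 0 ->
  {ae mu, forall x, X x -> T x = laguerre_map x}.
Proof.
move=> gap0.
have mgap : measurable_fun X (EFin \o gap T) by have /integrableP[] := gap_integrable.
have : (\int[mu]_(x in X) `|(EFin \o gap T) x| = 0)%E.
  under eq_integral => x /[!inE] Xx do rewrite /= ger0_norm ?gap_ge0//.
  rewrite -[LHS]fineK; first by rewrite -/(Rintegral _ _ _) gap0.
  exact: integrable_fin_num gap_integrable.
move=> /(ae_eq_integral_abs _ X_measurable mgap) gap_ae.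
have [T_y _ _] := T_transport.
apply: filterS2 (ae_laguerre_interior psi) gap_ae => x h g0 Xx.
have [i Li] := h Xx; have [j Tj] := T_y x Xx.
rewrite (laguerre_mapE Li) Tj; congr y; apply: (laguerre_interior_envelope Li).
have := g0 Xx; rewrite /= (gapE Tj) => -[/eqP]; rewrite subr_eq0 => /eqP <-.
by [].
Qed.

End gap_of_transport.

Lemma laguerre_map_gap : \int[mu]_(x in X) gap laguerre_map x = 0.
Proof.
rewrite /Rintegral (ae_eq_integral (cst 0%E)) ?integral0//.
- by have /integrableP[] := gap_integrable laguerre_map_transport.
- apply: filterS (ae_laguerre_interior psi) => x h /[dup] Xx /h[i Li].
  rewrite /= (gapE (laguerre_mapE Li)); congr EFin.
  by have /laguerreP[_ ->] := laguerre_interior_sub Li; rewrite subrr.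
Qed.

Lemma laguerre_map_optimal : optimal_map X mu c y nu laguerre_map.
Proof.
split=> [|T hT]; first exact: laguerre_map_transport.
rewrite (transport_costE laguerre_map_transport) (transport_costE hT) lee_fin.
by rewrite laguerre_map_gap lerD2l gap_int_ge0.
Qed.

Lemma optimal_map_unique T : optimal_map X mu c y nu T ->
  {ae mu, forall x, X x -> T x = laguerre_map x}.
Proof.
move=> [hT /(_ _ laguerre_map_transport)].
rewrite (transport_costE laguerre_map_transport) (transport_costE hT) lee_fin.
rewrite laguerre_map_gap lerD2l => gap_le0.
by apply: (gap_int_eq0 hT); apply: le_anti; rewrite gap_le0 gap_int_ge0.
Qed.

End laguerre_transport.
End semidiscrete_duality.

(** * Quadratic costs *)

Section quadratic_cost.
Variables (R : realType) (n : nat) (N L : 'M[R]_n).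
Hypothesis N_posdef : posdef N.
Hypothesis L_unit : L \in unitmx.

Definition quadratic_cost (x y : 'cV[R]_n) : R :=
  ((y - L *m x)^T *m invmx N *m (y - L *m x)) ord0 ord0.

Let N_unit := posdef_unit N_posdef.

Let invmx_sym : (invmx N)^T = invmx N.
Proof. by rewrite trmx_inv; case: N_posdef => ->. Qed.

Lemma quadratic_cost_ge0 x y : 0 <= quadratic_cost x y.
Proof.
rewrite /quadratic_cost; set d := y - _; pose p := invmx N *m d.
have -> : d^T *m invmx N *m d = p^T *m N *m p.
  by rewrite trmx_mul invmx_sym /p !mulmxA mulmxKV.
have [->|p0] := eqVneq p 0; first by rewrite mulmx0 mxE.
by case: N_posdef => _ /(_ p p0)/ltW.
Qed.

Lemma quadratic_cost_continuous y : continuous (quadratic_cost^~ y).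
Proof.
have cd : continuous (fun x : 'cV[R]_n => y - L *m x).
  have -> : (fun x : 'cV[R]_n => y - L *m x) = (fun x => y + (- L) *m x).
    by apply/funext => x; rewrite mulNmx.
  apply: (@continuous_addmx R 'cV[R]_n _ _ (fun=> y)); first exact: cst_continuous.
  apply: (@continuous_mulmx R 'cV[R]_n _ _ _ (fun=> - L) id); first exact: cst_continuous.
  by move=> x; exact: cvg_id.
apply: (continuous_mxP (fun x => (y - L *m x)^T *m invmx N *m (y - L *m x))).1.
apply: continuous_mulmx => //; apply: continuous_mulmx; first exact: continuous_trmx.
exact: cst_continuous.
Qed.

Definition cost_normal (y y' : 'cV[R]_n) : 'cV[R]_n :=
  - 2 *: ((y - y')^T *m invmx N *m L)^T.

Definition cost_offset (y y' : 'cV[R]_n) : R :=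
  ((y - y')^T *m invmx N *m (y + y')) ord0 ord0.

(** The quadratic terms in x cancel: a difference of squares is the product of
the difference, which does not involve x, and the sum, which is affine in x. *)
Lemma quadratic_costB x y y' : quadratic_cost x y - quadratic_cost x y' =
  ((cost_normal y y')^T *m x) ord0 ord0 + cost_offset y y'.
Proof.
have mxD (F G : 'M[R]_1) : (F + G) ord0 ord0 = F ord0 ord0 + G ord0 ord0 by rewrite mxE.
have mxN (F : 'M[R]_1) : (- F) ord0 ord0 = - F ord0 ord0 by rewrite mxE.
(* A difference of two values of a symmetric form factors. *)
have polarization (u v : 'cV[R]_n) :
    (u^T *m invmx N *m u) ord0 ord0 - (v^T *m invmx N *m v) ord0 ord0 =
    ((u - v)^T *m invmx N *m (u + v)) ord0 ord0.
  have uv : (u^T *m invmx N *m v) ord0 ord0 = (v^T *m invmx N *m u) ord0 ord0.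
    transitivity ((u^T *m invmx N *m v)^T ord0 ord0); first by rewrite [RHS]mxE.
    by rewrite !trmx_mul trmxK invmx_sym mulmxA.
  rewrite (linearB (@trmx R n 1))/= !mulmxBl !mulmxDr !(mxD, mxN) uv; lra.
rewrite /quadratic_cost polarization.
have -> : y - L *m x - (y' - L *m x) = y - y' by rewrite opprB addrA subrK.
have -> : y - L *m x + (y' - L *m x) = - 2 *: (L *m x) + (y + y').
  by rewrite addrACA -opprD addrC scaleNr scaler_nat mulr2n.
rewrite mulmxDr mxD -scalemxAr; congr (_ + _).
by rewrite /cost_normal linearZ/= trmxK -scalemxAl !mulmxA.
Qed.

Lemma cost_normal_neq0 y y' : y != y' -> cost_normal y y' != 0.
Proof.
move=> yy'; rewrite scaler_eq0 oppr_eq0 pnatr_eq0/= trmx_eq0.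
apply: contraNneq yy' => h; rewrite -subr_eq0 -trmx_eq0.
have : (y - y')^T *m invmx N *m L *m invmx L *m N = 0 by rewrite h !mul0mx.
by rewrite mulmxK// mulmxKV// => ->.
Qed.

End quadratic_cost.

(** * Polyhedral tessellations *)

Section polyhedra.
Variables (R : realType) (n : nat).
Implicit Types C : set 'cV[R]_n.

Lemma convex_polyhedronT : convex_polyhedron [set: 'cV[R]_n].
Proof.
exists 0%N, (fun=> 0), (fun=> 0); split; first by case.
by apply/seteqP; split => // x _ [].
Qed.

Lemma convex_polyhedron_half_space (a : 'cV[R]_n) (b : R) :
  a != 0 -> convex_polyhedron (half_space a b).
Proof.
move=> a0; exists 1%N, (fun=> a), (fun=> b); split=> //.
by apply/seteqP; split=> x; [move=> h i _|move=> h; exact: (h ord0 I)].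
Qed.

Lemma convex_polyhedronI C C' :
  convex_polyhedron C -> convex_polyhedron C' -> convex_polyhedron (C `&` C').
Proof.
move=> [k [a [b [a0 ->]]]] [k' [a' [b' [a'0 ->]]]].
exists (k + k')%N,
  (fun l : 'I_(k + k') => match fintype.split l with inl i => a i | inr i => a' i end),
  (fun l : 'I_(k + k') => match fintype.split l with inl i => b i | inr i => b' i end).
split.
  by move=> l; case: (fintype.split l).
apply/seteqP; split => x.
  by move=> [h h'] l _; case: (fintype.split l) => i; [exact: h|exact: h'].
move=> h; split=> l _.
  by have := h (lshift k' l) I; rewrite (unsplitK (inl l)).
by have := h (rshift k l) I; rewrite (unsplitK (inr l)).
Qed.

Lemma convex_polyhedron_bigcap (I : finType) (P : {pred I}) (C : I -> set 'cV[R]_n) :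
  (forall i, P i -> convex_polyhedron (C i)) ->
  convex_polyhedron (\bigcap_(i in [set` P]) C i).
Proof.
move=> polyC; rewrite (_ : [set` P] = [set` [seq i <- enum I | P i]]); last first.
  by apply/seteqP; split=> i /=; rewrite mem_filter mem_enum andbT.
rewrite bigcap_seq big_seq; elim/big_ind : _ => //.
- exact: convex_polyhedronT.
- exact: convex_polyhedronI.
- by move=> i; rewrite mem_filter => /andP[/polyC].
Qed.

End polyhedra.

Section affine_differences.
Variables (R : realType) (n r : nat) (X : set 'cV[R]_n).
Variables (c : 'cV[R]_n -> 'cV[R]_n -> R) (y : 'I_r -> 'cV[R]_n).
Variables (normal : 'I_r -> 'I_r -> 'cV[R]_n) (offset : 'I_r -> 'I_r -> R).
Hypothesis X_measurable : measurable X.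
Hypothesis c_measurable : forall i, measurable_fun setT (c^~ (y i)).
Hypothesis costB : forall i j x,
  c x (y i) - c x (y j) = ((normal i j)^T *m x) ord0 ord0 + offset i j.
Hypothesis normal_neq0 : forall i j, i != j -> normal i j != 0.

Lemma bisector_lebesgue0 i j k : i != j -> lebesgue_cV (bisector X c y i j k) = 0%E.
Proof.
move=> /normal_neq0 a0.
have H0 := lebesgue_hyperplane (k - offset i j) a0.
apply: (subset_measure0 _ _ _ H0); first exact: bisector_measurable.
- exact: hyperplane_measurable.
- by move=> x [_ /=]; rewrite costB => <-; rewrite addrK.
Qed.

(** This is where absolute continuity enters: ties between two cells lie on a
hyperplane, so they are Lebesgue-null, and then null for mu. *)
Lemma bisector_null (mu : {measure set 'cV[R]_n -> \bar R}) i j k :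
  mu `<< @lebesgue_cV R n -> i != j -> mu (bisector X c y i j k) = 0%E.
Proof.
move=> mu_ac ij.
suff : (@lebesgue_cV R n).-null_set (bisector X c y i j k).
  by move=> /mu_ac; apply => //; exact: bisector_measurable.
move=> S mS Sb; apply: (subset_measure0 mS _ Sb (bisector_lebesgue0 k ij)).
exact: bisector_measurable.
Qed.

Variable psi : 'I_r -> R.

Lemma laguerre_polyhedron i : laguerre X c y psi i = X `&`
  \bigcap_(j in [set` [pred j | j != i]])
    half_space (normal i j) (psi j - psi i - offset i j).
Proof.
apply/seteqP; split=> x [Xx h]; split=> // j ji.
  rewrite /half_space/=; have := h j ji; have := costB i j x; lra.
have := h j ji; rewrite /half_space/=; have := costB i j x; lra.
Qed.

Lemma laguerre_cell_polyhedron i : convex_polyhedron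
  (\bigcap_(j in [set` [pred j | j != i]])
    half_space (normal i j) (psi j - psi i - offset i j)).
Proof.
apply: convex_polyhedron_bigcap => j ji; apply: convex_polyhedron_half_space.
by apply: normal_neq0; rewrite eq_sym.
Qed.

Lemma laguerre_tessellation (i0 : 'I_r) : tessellation X (laguerre X c y psi).
Proof.
split.
  apply/seteqP; split=> [x [i _ []]//|x Xx].
  by have [i ei] := envelope_attained i0 c y psi x; exists i => //; apply/(laguerreP i0).
move=> i j ij; apply: (subset_measure0 _ _ _ (bisector_lebesgue0 (psi j - psi i) ij)).
- by apply: measurableI; exact: laguerre_measurable.
- exact: bisector_measurable.
- move=> x [[Xx Li] [_ Lj]]; split=> //=.
  have := Li j; rewrite eq_sym => /(_ ij); have := Lj i ij; lra.
Qed.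

End affine_differences.

(** * Transport for the minimum-energy cost *)

Lemma compact_family_bounded (R : realType) n r (X : set 'cV[R]_n)
    (f : 'I_r -> 'cV[R]_n -> R) : compact X -> (forall i, continuous (f i)) ->
  exists D, forall i x, X x -> f i x <= D.
Proof.
move=> cX cf.
have bnd i : exists D, forall x, X x -> f i x <= D.
  have [->|X0] := eqVneq X set0; first by exists 0.
  have [|x0 _ h] := compact_EVT_max _ cX (continuous_subspaceT (cf i)).
    exact/set0P.
  by exists (f i x0) => x Xx; apply: h; rewrite inE.
have [D hD] := choice bnd; exists (\sum_i `|D i|) => i x /hD h.
apply: le_trans (h i) _; apply: le_trans (ler_norm _) _.
by rewrite (bigD1 i)//= lerDl sumr_ge0.
Qed.

Theorem theorem1 (R : realType) (n m r : nat) (r_ge2 : (2 <= r)%N)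
    (X : set 'cV[R]_n) (X_compact : compact X)
    (mu : probability 'cV[R]_n R)
    (mu_supp : mu X = 1%E) (mu_ac : mu `<< @lebesgue_cV R n)
    (y : 'I_r -> 'cV[R]_n) (y_inj : injective y)
    (nu : 'I_r -> R) (nu_simplex : in_simplex nu)
    (A : R -> 'M[R]_n) (B : R -> 'M[R]_(n, m))
    (A_bounded : [bounded A t | t in `[0, 1]])
    (B_bounded : [bounded B t | t in `[0, 1]])
    (A_cont : {within `[0, 1], continuous A})
    (B_cont : {within `[0, 1], continuous B})
    (Phi : R -> R -> 'M[R]_n) (Phi_transition : is_state_transition A Phi)
    (AB_controllable : uniformly_controllable B Phi) :
  let c := min_energy A B in
  exists T : 'cV[R]_n -> 'cV[R]_n,
    [/\ optimal_map X mu c y nu T,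
        forall T', optimal_map X mu c y nu T' ->
          {ae mu, forall x, X x -> T' x = T x} &
        exists psi : 'I_r -> R,
          [/\ laguerre_mass X mu c y psi =1 nu,
              {ae mu, forall x, X x ->
                (exists i, laguerre_interior X c y psi i x) /\
                forall i, laguerre_interior X c y psi i x -> T x = y i},
              tessellation X (laguerre X c y psi),
              forall i, exists2 P, convex_polyhedron P &
                laguerre X c y psi i = X `&` P &
              convex_polyhedron X ->
                forall i, convex_polyhedron (laguerre X c y psi i)]].
Proof.
have i0 : 'I_r := Ordinal (ltnW r_ge2).
pose N := gramian B Phi 1 0; pose L := Phi 1 0.
have N_posdef : posdef N := gramian_posdef AB_controllable.
have L_unit : L \in unitmx.
  by apply: (transition_unit A_bounded Phi_transition); rewrite in_itv/= ?lexx ?ler01.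
have -> : min_energy A B = quadratic_cost N L.
  apply/funext => x; apply/funext => z.
  exact: (min_energyE A_bounded B_cont Phi_transition AB_controllable).
move=> c.
have X_measurable : measurable X := compact_measurable_mx X_compact.
have c_cont i : continuous (c^~ (y i)) := @quadratic_cost_continuous _ _ N L _.
have c_measurable i : measurable_fun setT (c^~ (y i)).
  exact: continuous_measurable_mx (c_cont i).
have [D c_leD] := compact_family_bounded X_compact c_cont.
have c_bounded i x : X x -> 0 <= c x (y i) <= D.
  by move=> Xx; rewrite quadratic_cost_ge0//= c_leD.
pose normal i j := cost_normal N L (y i) (y j).
pose offset i j := cost_offset N (y i) (y j).
have costB i j x : c x (y i) - c x (y j) =
    ((normal i j)^T *m x) ord0 ord0 + offset i j by exact: quadratic_costB.
have normal_neq0 i j : i != j -> normal i j != 0.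
  by move=> ij; apply: cost_normal_neq0 => //; rewrite (inj_eq y_inj).
have ties_null i j k : i != j -> mu (bisector X c y i j k) = 0%E.
  by move=> ij; exact: (bisector_null X_measurable c_measurable costB normal_neq0).
have [psi psi_mass] := exists_laguerre_potential i0 X_measurable mu_supp
  c_measurable c_bounded ties_null nu_simplex.
exists (laguerre_map i0 X c y psi); split.
- exact: (laguerre_map_optimal _ _ _ c_bounded).
- move=> T; exact: (optimal_map_unique _ _ _ c_bounded).
exists psi; split.
- move=> i; rewrite /laguerre_mass Rintegral_cst ?mul1r; last exact: laguerre_measurable.
  exact: (congr1 fine (etrans (esym (laguerre_interior_measure i0 X_measurable
    c_measurable ties_null psi i)) (psi_mass i))).
- apply: filterS (ae_laguerre_interior i0 X_measurable c_measurable ties_null psi) => x h /h Lx.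
  by split=> // i; exact: laguerre_mapE.
- exact: (laguerre_tessellation X_measurable c_measurable costB normal_neq0 psi i0).
- move=> i; eexists; first exact: (laguerre_cell_polyhedron offset normal_neq0 psi i).
  exact: laguerre_polyhedron.
- move=> X_poly i; rewrite (laguerre_polyhedron X costB psi i).
  by apply: convex_polyhedronI => //; exact: laguerre_cell_polyhedron.
Qed.
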